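(* Let $M$ be a smooth manifold with a generalized Riemannian metric $G$ corresponding to the pair $(\gamma,\psi)$, and let $E\subset\mathbf{T}M$ be an almost Dirac structure with associated isometry $F_E$ of $(TM,\gamma)$. Then $E$ is a parallel Dirac structure on $(M,G)$ (i.e., $E$ is integrable and is preserved by the canonical big connection of $G$) if and only if the following two conditions hold for all vector fields $X,Y,Z$ on $M$: $$\gamma\big(F_EZ,(D_XF_E)(Y)\big)=\tfrac12\big[d\psi(X,Y,Z)+d\psi(X,F_EY,F_EZ)\big],$$ $$d\psi(X,Y,Z)+d\psi(F_EX,F_EY,F_EZ)=0,$$ where $D$ is the Levi-Civita connection of $\gamma$.
   Context: $M$ is a smooth $m$-dimensional manifold, $\mathbf{T}M=TM\oplus T^*M$, with neutral metric $g((X,\alpha),(Y,\mu))=\alpha(Y)+\mu(X)$ and Courant bracket $[(X,\alpha),(Y,\mu)]=([X,Y],L_X\mu-L_Y\alpha+\frac12 d(\alpha(Y)-\mu(X)))$. An almost Dirac structure is a maximal (rank $m$) $g$-isotropic subbundle $E\subset\mathbf{T}M$; it is integrable (a Dirac structure) if $\Gamma E$ is closed under the Courant bracket. A generalized Riemannian metric $G$ is a positive definite metric on $\mathbf{T}M$ with a decomposition $\mathbf{T}M=V_+\oplus V_-$, where $V_\pm$ are maximal positive, respectively negative, subbundles of $g$, $V_+\perp V_-$ (for $g$ and $G$) and $G|_{V_\pm}=\pm g$; let $\phi|_{V_\pm}=\pm Id$, so $G(\mathcal X,\mathcal Y)=g(\phi\mathcal X,\mathcal Y)$. $G$ is equivalent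 to a pair $(\gamma,\psi)$, $\gamma$ a Riemannian metric on $M$ and $\psi\in\Omega^2(M)$, via $V_\pm=\{(X,\flat_{\psi\pm\gamma}X): X\in TM\}$, where $\flat_bX=b(X,\cdot)$ for a bilinear form $b$. The canonical big connection $\nabla$ of $G$ is the connection on $\mathbf{T}M$ given by $\nabla_X(Y,\flat_{\psi\pm\gamma}Y)=(D^\pm_XY,\flat_{\psi\pm\gamma}D^\pm_XY)$, where $D^\pm_XY=D_XY\pm\frac12\sharp_\gamma[i(Y)i(X)d\psi]$, $D$ is the Levi-Civita connection of $\gamma$ and $\sharp_\gamma=\flat_\gamma^{-1}$. $\nabla$ preserves $E$ if $\nabla_X\mathcal Y\in\Gamma E$ for all vector fields $X$ and all $\mathcal Y\in\Gamma E$. Given $E$, let $\Psi_E$ be the endomorphism of $\mathbf{T}M$ with $+1$-eigenbundle $E$ and $-1$-eigenbundle $E^{\perp_G}=\phi(E)$. $\Psi_E$ interchanges $V_+$ and $V_-$, and $F_E\in \mathrm{Iso}(TM)$ is the bundle isomorphism determined by $\Psi_E(X,\flat_{\psi+\gamma}X)=(F_EX,\flat_{\psi-\gamma}F_EX)$; it satisfies $\gamma(F_EX,F_EY)=\gamma(X,Y)$. *)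

(* Defs.v *)
From HB Require Import structures.
From mathcomp Require Import all_boot all_order all_algebra.
From mathcomp Require Import all_classical all_reals all_analysis.

Set Implicit Arguments.
Unset Strict Implicit.
Unset Printing Implicit Defensive.

Import Order.TTheory GRing.Theory Num.Theory.
Import numFieldNormedType.Exports.

Local Open Scope classical_set_scope.
Local Open Scope ring_scope.

(** * Smooth manifolds *)

(* [Ck k U f]: f is of class C^k on the open set U. *)
Fixpoint Ck (R : realType) (V W : normedModType R) (k : nat) (U : set V)
    (f : V -> W) : Prop :=
  if k is k'.+1 then
    (forall x, U x -> differentiable f x) /\
    (forall v, Ck k' U (fun x => 'D_v f x))
  else forall x, U x -> {for x, continuous f}.

Definition smooth_on (R : realType) (V W : normedModType R) (U : set V)
    (f : V -> W) : Prop := forall k, Ck k U f.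

(* [cinv] is meaningful on the image of [cdom] only. *)
Record chart (R : realType) (m : nat) (M : topologicalType) : Type := Chart {
  cdom : set M;
  cmap :> M -> 'rV[R]_m;
  cinv : 'rV[R]_m -> M;
  cdom_open : open cdom;
  cimg_open : open (cmap @` cdom);
  cmap_cont : forall p, cdom p -> {for p, continuous cmap};
  cinv_cont : forall x, (cmap @` cdom) x -> {for x, continuous cinv};
  cmapK : forall p, cdom p -> cinv (cmap p) = p }.

(* The chosen chart [chart_at p] around p only serves to represent tangent
   vectors at p, see below. *)
Record smoothManifold (R : realType) (m : nat) : Type := SmoothManifold {
  carrier :> topologicalType;
  carrier_hausdorff : hausdorff_space carrier;
  carrier_second_countable : @second_countable carrier;
  atlas : set (chart R m carrier);
  atlas_compat : forall c c', atlas c -> atlas c' ->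
    smooth_on (c @` (cdom c `&` cdom c')) (c' \o cinv c);
  chart_at : carrier -> chart R m carrier;
  chart_at_atlas : forall p, atlas (chart_at p);
  chart_at_dom : forall p, cdom (chart_at p) p }.

Section Tensors.
Context {R : realType} {m : nat} {M : smoothManifold R m}.

(* T_pM is 'rV[R]_m: a tangent vector at p is represented by its components in
   the chart [chart_at p].  T*_pM is 'rV[R]_m as well (components in the dual
   frame), bilinear forms and endomorphisms of T_pM are matrices, the latter
   acting on row vectors from the right.  The fibre of TM (+) T*M at p is the
   product of the two. *)
Definition vecfield : Type := M -> 'rV[R]_m.
Definition covfield : Type := M -> 'rV[R]_m.
Definition bigfield : Type := M -> 'rV[R]_m * 'rV[R]_m.

Definition ev (a u : 'rV[R]_m) : R := (a *m u^T) 0 0.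
Definition bil (b : 'M[R]_m) (u v : 'rV[R]_m) : R := (u *m b *m v^T) 0 0.
(* b(u, .) *)
Definition flat (b : 'M[R]_m) (u : 'rV[R]_m) : 'rV[R]_m := u *m b.
Definition sharp (b : 'M[R]_m) (a : 'rV[R]_m) : 'rV[R]_m := a *m invmx b.
Definition bvec (i : 'I_m) : 'rV[R]_m := delta_mx 0 i.

(* Components in the chart c of v in T_qM, q in the domain of c. *)
Definition coords (c : chart R m M) (q : M) (v : 'rV[R]_m) : 'rV[R]_m :=
  'D_v (c \o cinv (chart_at q)) (chart_at q q).

(* The vector of T_qM whose components in the chart c are u. *)
Definition tvec (c : chart R m M) (q : M) (u : 'rV[R]_m) : 'rV[R]_m :=
  'D_u (chart_at q \o cinv c) (c q).

(* The covector of T*_qM whose components in the chart c are a. *)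
Definition tcov (c : chart R m M) (q : M) (a : 'rV[R]_m) : 'rV[R]_m :=
  \row_i ev a (coords c q (bvec i)).

(* Smoothness on an open set W of something that is given in each chart. *)
Definition chartwise_smooth (V : normedModType R) (W : set M)
    (f : chart R m M -> M -> V) : Prop :=
  forall c, atlas c -> smooth_on (c @` (cdom c `&` W)) (f c \o cinv c).

Definition smooth_fun (f : M -> R) : Prop :=
  @chartwise_smooth R^o setT (fun=> f).

Definition smooth_vec (W : set M) (X : vecfield) : Prop :=
  chartwise_smooth W (fun c q => coords c q (X q)).

Definition smooth_cov (W : set M) (a : covfield) : Prop :=
  forall u, @chartwise_smooth R^o W (fun c q => ev (a q) (tvec c q u)).

Definition smooth_bil (b : M -> 'M[R]_m) : Prop :=
  forall u v,
    @chartwise_smooth R^o setT (fun c q => bil (b q) (tvec c q u) (tvec c q v)).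

Definition smooth_big (W : set M) (s : bigfield) : Prop :=
  smooth_vec W (fun q => (s q).1) /\ smooth_cov W (fun q => (s q).2).

(** * Differential calculus *)

(* Derivative of f at p in the direction u in T_pM. *)
Definition dir (V : normedModType R) (u : 'rV[R]_m) (f : M -> V) (p : M) : V :=
  'D_u (f \o cinv (chart_at p)) (chart_at p p).

Definition dfun (f : M -> R) : covfield :=
  fun p => \row_i dir (bvec i) (f : M -> R^o) p.

(* Brackets, Lie derivatives and exterior derivatives at p are computed from
   components in the chart [chart_at p]. *)
Definition lie_bracket (X Y : vecfield) : vecfield := fun p =>
  dir (X p) (fun q => coords (chart_at p) q (Y q)) p -
  dir (Y p) (fun q => coords (chart_at p) q (X q)) p.

(* (L_X mu)_i = X^j d_j mu_i + mu_j d_i X^j *)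
Definition lie_derivative (X : vecfield) (mu : covfield) : covfield := fun p =>
  \row_i (dir (X p)
            (fun q => ev (mu q) (tvec (chart_at p) q (bvec i)) : R^o) p +
          ev (mu p) (dir (bvec i) (fun q => coords (chart_at p) q (X q)) p)).

(* Normalized as dpsi(X, Y, Z) = X psi(Y, Z) - ... , without factor 1/3. *)
Definition d2form (psi : M -> 'M[R]_m) (p : M) (u v w : 'rV[R]_m) : R :=
  let psi_ a b q : R^o :=
    bil (psi q) (tvec (chart_at p) q a) (tvec (chart_at p) q b) in
  dir u (psi_ v w) p - dir v (psi_ u w) p + dir w (psi_ u v) p.

Definition courant (s t : bigfield) : bigfield := fun p =>
  let X q := (s q).1 in let a q := (s q).2 in
  let Y q := (t q).1 in let mu q := (t q).2 in
  (lie_bracket X Y p,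
   lie_derivative X mu p - lie_derivative Y a p
   + 2^-1 *: dfun (fun q => ev (a q) (Y q) - ev (mu q) (X q)) p).

(** * Connections *)

(* A connection on a vector bundle with fibre V, whose smooth global sections
   are singled out by [smooth_sec]; only its values on smooth arguments
   matter. *)
Definition connection (V : lmodType R) (smooth_sec : (M -> V) -> Prop)
    (N : vecfield -> (M -> V) -> (M -> V)) : Prop :=
  [/\ forall X s, smooth_vec setT X -> smooth_sec s -> smooth_sec (N X s),
      forall X Y s, smooth_vec setT X -> smooth_vec setT Y -> smooth_sec s ->
        forall p, N (fun q => X q + Y q) s p = N X s p + N Y s p,
      forall f X s, smooth_fun f -> smooth_vec setT X -> smooth_sec s ->
        forall p, N (fun q => f q *: X q) s p = f p *: N X s p,
      forall X s t, smooth_vec setT X -> smooth_sec s -> smooth_sec t ->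
        forall p, N X (fun q => s q + t q) p = N X s p + N X t p
    & forall f X s, smooth_fun f -> smooth_vec setT X -> smooth_sec s ->
        forall p, N X (fun q => f q *: s q) p =
          dir (X p) (f : M -> R^o) p *: s p + f p *: N X s p].

Definition riemannian_metric (gam : M -> 'M[R]_m) : Prop :=
  [/\ smooth_bil gam,
      forall p u v, bil (gam p) u v = bil (gam p) v u
    & forall p u, u != 0 -> 0 < bil (gam p) u u].

Definition two_form (psi : M -> 'M[R]_m) : Prop :=
  smooth_bil psi /\ forall p u v, bil (psi p) u v = - bil (psi p) v u.

Definition levi_civita (gam : M -> 'M[R]_m)
    (D : vecfield -> vecfield -> vecfield) : Prop :=
  [/\ connection (smooth_vec setT) D,
      forall X Y, smooth_vec setT X -> smooth_vec setT Y ->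
        forall p, D X Y p - D Y X p = lie_bracket X Y p
    & forall X Y Z, smooth_vec setT X -> smooth_vec setT Y ->
        smooth_vec setT Z -> forall p,
        dir (X p) (fun q => bil (gam q) (Y q) (Z q) : R^o) p =
          bil (gam p) (D X Y p) (Z p) + bil (gam p) (Y p) (D X Z p)].

(** * Subbundles, almost Dirac structures, generalized metrics *)

Definition neutral (s t : 'rV[R]_m * 'rV[R]_m) : R := ev s.2 t.1 + ev t.2 s.1.

Definition subbundle (k : nat) (E : M -> {vspace 'rV[R]_m * 'rV[R]_m}) : Prop :=
  forall p, exists W : set M, exists s : 'I_k -> bigfield,
    [/\ open W, W p, forall i, smooth_big W (s i)
      & forall q, W q -> basis_of (E q) [seq s i q | i : 'I_k]].

Definition global_section (E : M -> {vspace 'rV[R]_m * 'rV[R]_m})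
    (s : bigfield) : Prop := smooth_big setT s /\ forall p, s p \in E p.

Definition almost_dirac (E : M -> {vspace 'rV[R]_m * 'rV[R]_m}) : Prop :=
  subbundle m E /\
  forall p s t, s \in E p -> t \in E p -> neutral s t = 0.

Definition courant_integrable (E : M -> {vspace 'rV[R]_m * 'rV[R]_m}) : Prop :=
  forall s t, global_section E s -> global_section E t ->
    global_section E (courant s t).

(* [gplus], [gminus] are V_+, V_-; since the neutral metric has signature
   (m, m), maximality of V_+ and V_- means that they have rank m. *)
Record gen_metric : Type := GenMetric {
  gform :> M -> 'rV[R]_m * 'rV[R]_m -> 'rV[R]_m * 'rV[R]_m -> R;
  gplus : M -> {vspace 'rV[R]_m * 'rV[R]_m};
  gminus : M -> {vspace 'rV[R]_m * 'rV[R]_m};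
  gform_smooth : forall u a v b,
    @chartwise_smooth R^o setT (fun c q =>
      gform q (tvec c q u, tcov c q a) (tvec c q v, tcov c q b));
  gform_linear : forall p k s t r,
    gform p (k *: s + t) r = k * gform p s r + gform p t r;
  gform_sym : forall p s t, gform p s t = gform p t s;
  gform_pos : forall p s, s != 0 -> 0 < gform p s s;
  gplus_subbundle : subbundle m gplus;
  gminus_subbundle : subbundle m gminus;
  gplus_positive : forall p s, s \in gplus p -> s != 0 -> 0 < neutral s s;
  gminus_negative : forall p s, s \in gminus p -> s != 0 -> neutral s s < 0;
  gdecomp : forall p, (gplus p + gminus p)%VS = fullv /\
    (gplus p :&: gminus p)%VS = 0%VS;
  gperp : forall p s t, s \in gplus p -> t \in gminus p ->
    neutral s t = 0 /\ gform p s t = 0;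
  gform_plus : forall p s t, s \in gplus p -> t \in gplus p ->
    gform p s t = neutral s t;
  gform_minus : forall p s t, s \in gminus p -> t \in gminus p ->
    gform p s t = - neutral s t }.

(* (u, flat_{psi + eps gam} u), for eps = 1 or -1 *)
Definition graph_lift (gam psi : M -> 'M[R]_m) (eps : R) (p : M)
    (u : 'rV[R]_m) : 'rV[R]_m * 'rV[R]_m := (u, flat (psi p + eps *: gam p) u).

Definition corresponds (G : gen_metric) (gam psi : M -> 'M[R]_m) : Prop :=
  forall p s,
    (s \in gplus G p <-> exists u, s = graph_lift gam psi 1 p u) /\
    (s \in gminus G p <-> exists u, s = graph_lift gam psi (-1) p u).

(** * The canonical big connection and the isometry F_E *)

(* D^{+} for eps = 1, D^{-} for eps = -1; the row is i(Y) i(X) dpsi. *)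
Definition Deps (gam psi : M -> 'M[R]_m) (D : vecfield -> vecfield -> vecfield)
    (eps : R) (X Y : vecfield) : vecfield := fun p =>
  D X Y p + (eps / 2) *:
    sharp (gam p) (\row_i d2form psi p (X p) (Y p) (bvec i)).

Definition big_connection (gam psi : M -> 'M[R]_m)
    (D : vecfield -> vecfield -> vecfield)
    (nabla : vecfield -> bigfield -> bigfield) : Prop :=
  connection (smooth_big setT) nabla /\
  forall eps, eps = 1 \/ eps = -1 ->
    forall X Y, smooth_vec setT X -> smooth_vec setT Y -> forall p,
      nabla X (fun q => graph_lift gam psi eps q (Y q)) p =
      graph_lift gam psi eps p (Deps gam psi D eps X Y p).

Definition preserves (nabla : vecfield -> bigfield -> bigfield)
    (E : M -> {vspace 'rV[R]_m * 'rV[R]_m}) : Prop :=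
  forall X s, smooth_vec setT X -> global_section E s ->
    global_section E (nabla X s).

Definition is_Psi (G : gen_metric) (E : M -> {vspace 'rV[R]_m * 'rV[R]_m})
    (Psi : M -> 'End(('rV[R]_m * 'rV[R]_m)%type)) : Prop :=
  forall p, passmx.leigenspace (Psi p) 1 = E p /\
    forall s, s \in passmx.leigenspace (Psi p) (-1) <->
      (forall e, e \in E p -> G p s e = 0).

Definition is_F (gam psi : M -> 'M[R]_m)
    (Psi : M -> 'End(('rV[R]_m * 'rV[R]_m)%type)) (F : M -> 'M[R]_m) : Prop :=
  forall p u,
    Psi p (graph_lift gam psi 1 p u) = graph_lift gam psi (-1) p (u *m F p).

Definition endo_app (F : M -> 'M[R]_m) (X : vecfield) : vecfield :=
  fun p => X p *m F p.

(* (D_X F)(Y) *)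
Definition cov_deriv (D : vecfield -> vecfield -> vecfield) (F : M -> 'M[R]_m)
    (X Y : vecfield) : vecfield :=
  fun p => D X (endo_app F Y) p - endo_app F (D X Y) p.

End Tensors.

Arguments vecfield {R m} M.
Arguments covfield {R m} M.
Arguments bigfield {R m} M.
Arguments gen_metric {R m} M.

(* Main.v *)
From HB Require Import structures.
From mathcomp Require Import all_boot all_order all_algebra perm.
From mathcomp Require Import all_classical all_reals all_analysis.
Require Import Defs.
From mathcomp Require Import ring lra.

Set Implicit Arguments.
Unset Strict Implicit.
Unset Printing Implicit Defensive.

Import Order.TTheory GRing.Theory Num.Theory.
Import numFieldNormedType.Exports.

Local Open Scope classical_set_scope.
Local Open Scope ring_scope.

(** Write l+ u and l- u for the lifts (u, flat_(psi +/- gam) u) spanning V+ and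
V-.  Since E is isotropic of rank m, its fibres are graphs of isometries from V+
to V-, namely E = { l+ u + l- (F u) }, and F is the given isometry F_E
([dirac_fiberP], [F_isometry]).  Hence the global sections of E are exactly
s_X = l+ X + l- (F X) for X a global field ([global_section_dirac]).

Parallelism.  The big connection acts on s_Y componentwise, by D^+ on Y and by
D^- on F Y, so nabla_X s_Y lies in E iff D^-_X (F Y) = F (D^+_X Y).  Pairing
this with F w by the metric and using that F is an isometry gives the first
equation of the theorem, with w in place of Z ([nabla_in_dirac]).

Integrability.  The fibres of E are maximal isotropic, so a bracket [s_X, s_Y]
lies in E iff it pairs to zero with every s_Z.  Put P = X + F X, A = X - F X;
then s_X = (P, psi P + gam A), and likewise (Q, B) from Y and (S, C) from Z.  The
Cartan formula for d psi and the Levi-Civita axioms turn the pairing into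
  dpsi(P, Q, S) + T_P(Y, Z) - T_Q(X, Z) + T_S(X, Y),
where T_U(X, Y) = gam(D_U A, Q) + gam(B, D_U P) is -2 gam((D_U F) X, F Y).  When
the first equation holds, each T is a value of - d psi, and expanding by
trilinearity leaves -2 (dpsi(X, Y, Z) + dpsi(F X, F Y, F Z))
([courant_pairing]).  Given the first equation, integrability is therefore the
second one.

Two analytic points remain.  First, the equations are stated for global fields
and the conclusions are pointwise, so every tangent vector must extend to a
global smooth field; this needs a bump function ([exists_smooth_vec]).  Second,
F X and the brackets must be smooth.  For F this follows from a local frame of E
and Cramer's rule ([smooth_F]).  For brackets no change of charts is needed: the
Lie bracket is smooth because it is a difference of covariant derivatives, and
d psi because it is the difference between D^+ and D, both of which preserve
smoothness. *)

(** * Closure properties of C^k maps *)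

Section CkBasics.
Context {R : realType} {V W : normedModType R}.
Implicit Types (U : set V) (f g : V -> W).

Lemma near_eq_differentiable (f g : V -> W) x :
  {near x, f =1 g} -> differentiable f x -> differentiable g x.
Proof.
move=> fg df; have [dfc dfE] := (diff_locallyP x f).1 df.
have gE : g \o shift x = cst (g x) + 'd f x +o_ (0 : V) id.
  apply/eqaddoP => e e0; move/eqaddoP: dfE => /(_ e e0) H.
  near=> h; have -> : (g \o shift x - (cst (g x) + 'd f x)) h =
      (f \o shift x - (cst (f x) + 'd f x)) h.
    rewrite /= !fctE /=; congr (_ - (_ + _)); last first.
      by rewrite -(nbhs_singleton fg).
    apply/esym; near: h.
    have sx : h + x @[h --> (0 : V)] --> x.
      by rewrite -[X in _ --> X]add0r; apply: cvgD; [exact: cvg_id|exact: cvg_cst].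
    exact: (sx _ fg).
  by near: h.
apply/diff_locallyP; rewrite (diff_unique dfc gE); split => //.
Unshelve. all: by end_near. Qed.

Lemma Ck_sub k U U' f : U' `<=` U -> Ck k U f -> Ck k U' f.
Proof.
elim: k f => [|k IH] f sU /=; first by move=> H x /sU /H.
by move=> [H1 H2]; split=> [x /sU /H1 //|v]; apply: IH.
Qed.

(** The derivatives in [Ck] are those of f itself, not of a restriction of f to U,
so membership is decided point by point. *)
Lemma Ck_local k U f : (forall x, U x -> Ck k [set x] f) -> Ck k U f.
Proof.
elim: k f => [|k IH] f /= H; first by move=> x /H; exact.
split=> [x /H [H1 _]|v]; first exact: H1.
by apply: IH => x /H [_]; exact.
Qed.

Lemma Ck_ext k U f g : open U -> (forall x, U x -> f x = g x) ->
  Ck k U f -> Ck k U g.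
Proof.
move=> oU; elim: k f g => [|k IH] f g fg /=.
  move=> H x Ux; have fgn : {near x, f =1 g}.
    by apply: filterS (open_nbhs_nbhs (conj oU Ux)) => y; exact: fg.
  change (g t @[t --> x] --> g x); rewrite -(fg x Ux).
  apply: cvg_trans (H x Ux).
  by apply: near_eq_cvg; apply: filterS fgn => y ->.
have fgn x : U x -> {near x, f =1 g}.
  by move=> Ux; apply: filterS (open_nbhs_nbhs (conj oU Ux)) => y; exact: fg.
move=> [H1 H2]; split=> [x Ux|v].
  by apply: near_eq_differentiable (H1 x Ux); exact: fgn.
by apply: IH (H2 v) => x Ux; apply: near_eq_derive; exact: fgn.
Qed.

Lemma Ck_pred k U f : Ck k.+1 U f -> Ck k U f.
Proof.
elim: k f => [|k IH] f [H1 H2].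
  by move=> x Ux; apply: differentiable_continuous; exact: H1.
by split=> // v; apply: IH; exact: H2.
Qed.

Lemma Ck_cst k U (a : W) : Ck k U (fun=> a).
Proof.
elim: k a => [|k IH] a /=; first by move=> x _; exact: cst_continuous.
split=> [x _|v]; first exact: differentiable_cst.
by have -> : (fun x : V => 'D_v (fun=> a) x) = fun=> 0
  by apply/funext => x; exact: derive_cst.
Qed.

Lemma CkD k U f g : open U -> Ck k U f -> Ck k U g ->
  Ck k U (fun x => f x + g x).
Proof.
move=> oU; elim: k f g => [|k IH] f g /=.
  by move=> Hf Hg x Ux; apply: cvgD; [exact: Hf|exact: Hg].
move=> [Hf Hf'] [Hg Hg']; split=> [x Ux|v].
  by apply: differentiableD; [exact: Hf|exact: Hg].
apply: (Ck_ext oU _ (IH _ _ (Hf' v) (Hg' v))) => x Ux; apply/esym.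
by apply: deriveD; apply: diff_derivable; [exact: Hf|exact: Hg].
Qed.

Lemma Ck_sum k U (I : Type) (r : seq I) (P : pred I) (h : I -> V -> W) : open U ->
  (forall i, P i -> Ck k U (h i)) -> Ck k U (fun x => \sum_(i <- r | P i) h i x).
Proof.
move=> oU H; elim: r => [|i r IH].
  by apply: (Ck_ext oU _ (Ck_cst k U 0)) => x _; rewrite big_nil.
case Pi: (P i); last by apply: (Ck_ext oU _ IH) => x _; rewrite big_cons Pi.
apply: (Ck_ext oU _ (CkD oU (H i Pi) IH)) => x _.
by rewrite big_cons Pi.
Qed.

End CkBasics.

Section CkLin.
Context {R : realType} {V W W' : normedModType R}.

Lemma Ck_lin k (U : set V) (f : V -> W) (L : {linear W -> W'}) :
  open U -> continuous L -> Ck k U f -> Ck k U (fun x => L (f x)).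
Proof.
move=> oU cL; elim: k f => [|k IH] f /=.
  by move=> Hf x Ux; apply: continuous_comp; [exact: Hf|exact: cL].
move=> [Hf Hf']; have dL y : differentiable L y by exact: linear_differentiable.
split=> [x Ux|v].
  by apply: differentiable_comp => //; exact: Hf.
apply: (Ck_ext oU _ (IH _ (Hf' v))) => x Ux; apply/esym.
rewrite deriveE; last by apply: differentiable_comp => //; exact: Hf.
rewrite (diff_comp (Hf x Ux) (dL _)) /= (diff_lin _ cL) deriveE //.
exact: Hf.
Qed.

End CkLin.

Section CkScalar.
Context {R : realType} {V : normedModType R}.
Implicit Types (U : set V) (f g : V -> R^o).

Lemma CkZ (W : normedModType R) k U f (w : W) : open U -> Ck k U f ->
  Ck k U (fun x => (f x : R) *: w).
Proof.
move=> oU; elim: k f => [|k IH] f /=.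
  by move=> Hf x Ux; apply: cvgZr_tmp; exact: Hf.
move=> [Hf Hf']; split=> [x Ux|v].
  by apply: differentiableZl; exact: Hf.
apply: (Ck_ext oU _ (IH _ (Hf' v))) => x Ux; apply/esym.
rewrite deriveE; last by apply: differentiableZl; exact: Hf.
by rewrite diffZl ?deriveE //; exact: Hf.
Qed.

Lemma CkM k U f g : open U -> Ck k U f -> Ck k U g ->
  Ck k U (fun x => f x * g x : R^o).
Proof.
move=> oU; elim: k f g => [|k IH] f g.
  by move=> Hf Hg x Ux; apply: cvgM; [exact: Hf|exact: Hg].
move=> Hf0 Hg0; have Hf1 := Ck_pred Hf0; have Hg1 := Ck_pred Hg0.
move: Hf0 Hg0 => [Hf Hf'] [Hg Hg']; split=> [x Ux|v].
  by apply: differentiableM; [exact: Hf|exact: Hg].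
apply: (Ck_ext oU _ (CkD oU (IH _ _ Hf1 (Hg' v)) (IH _ _ Hg1 (Hf' v)))).
move=> x Ux; apply/esym.
by apply: deriveM; apply: diff_derivable; [exact: Hf|exact: Hg].
Qed.

Lemma CkN k U f : open U -> Ck k U f -> Ck k U (fun x => - f x : R^o).
Proof.
move=> oU Hf; apply: (Ck_ext oU _ (CkM oU (Ck_cst k U (-1 : R^o)) Hf)) => x _.
by rewrite mulN1r.
Qed.

Lemma CkV k U f : open U -> (forall x, U x -> f x != 0) -> Ck k U f ->
  Ck k U (fun x => (f x)^-1 : R^o).
Proof.
move=> oU f0; elim: k => [|k IH] Hf0.
  by move=> x Ux; apply: cvgV; [exact: f0|exact: Hf0].
have Hf1 := Ck_pred Hf0; move: Hf0 => [Hf Hf'].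
have dV x : U x -> differentiable (fun x => (f x)^-1 : R^o) x.
  by move=> Ux; exact: (@differentiableV R V f x (Hf x Ux) (f0 x Ux)).
split=> // v.
have HV := IH Hf1.
apply: (Ck_ext oU _ (CkN oU (CkM oU (CkM oU HV HV) (Hf' v)))) => x Ux.
rewrite (deriveE _ (dV x Ux)) (@diffV R V f x (Hf x Ux) (f0 x Ux)) /=.
rewrite (deriveE _ (Hf x Ux)).
by rewrite -mulNr -invfM -expr2.
Qed.

Lemma CkX k U f n : open U -> Ck k U f -> Ck k U (fun x => f x ^+ n : R^o).
Proof.
move=> oU Hf; elim: n => [|n IH].
  by apply: (Ck_ext oU _ (Ck_cst k U (1 : R^o))) => x _; rewrite expr0.
by apply: (Ck_ext oU _ (CkM oU Hf IH)) => x _; rewrite exprS.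
Qed.

Lemma Ck_prod k U (I : Type) (r : seq I) (h : I -> V -> R^o) : open U ->
  (forall i, Ck k U (h i)) -> Ck k U (fun x => \prod_(i <- r) h i x : R^o).
Proof.
move=> oU H; elim: r => [|i r IH].
  by apply: (Ck_ext oU _ (Ck_cst k U (1 : R^o))) => x _; rewrite big_nil.
by apply: (Ck_ext oU _ (CkM oU (H i) IH)) => x _; rewrite big_cons.
Qed.

End CkScalar.

Lemma derive_comp (R : realType) (V W W' : normedModType R) (f : V -> W)
    (g : W -> W') x v : differentiable f x -> differentiable g (f x) ->
  'D_v (fun y => g (f y)) x = 'D_('D_v f x) g (f x).
Proof.
move=> df dg; rewrite deriveE; last by apply: differentiable_comp.
rewrite (_ : (fun y => g (f y)) = g \o f) // (diff_comp df dg) /=.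
by rewrite -(deriveE v df) -deriveE.
Qed.

Lemma derive_dir_sum (R : realType) n (W : normedModType R) (g : 'rV[R]_n -> W)
    y (w : 'rV[R]_n) : differentiable g y ->
  'D_w g y = \sum_j w 0 j *: 'D_(delta_mx 0 j) g y.
Proof.
move=> dg; rewrite deriveE // {1}(row_sum_delta w) linear_sum.
by apply: eq_bigr => j _; rewrite linearZ /= deriveE.
Qed.

Section CkRow.
Context {R : realType} {V : normedModType R} {n : nat}.
Implicit Types (U : set V) (f : V -> 'rV[R]_n).

Lemma Ck_coord k U f j : open U -> Ck k U f -> Ck k U (fun x => f x 0 j : R^o).
Proof.
move=> oU.
have lin : linear (fun N : 'rV[R]_n => N 0 j : R^o).
  by move=> a u v; rewrite !mxE.
pose L0 := GRing.isLinear.Build _ _ _ _ _ lin.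
pose L : {linear 'rV[R]_n -> R^o} := HB.pack (fun N : 'rV[R]_n => N 0 j : R^o) L0.
apply: (@Ck_lin _ _ _ _ _ _ _ L) => //.
exact: coord_continuous.
Qed.

Lemma Ck_row k U f : open U -> (forall j, Ck k U (fun x => f x 0 j : R^o)) ->
  Ck k U f.
Proof.
move=> oU H.
apply: (Ck_ext oU _ (Ck_sum (index_enum _) (P := xpredT) oU
  (fun j _ => CkZ (delta_mx 0 j) oU (H j)))) => x _.
by rewrite -row_sum_delta.
Qed.

(** The chain rule expresses a derivative of the composite through the partial
derivatives of g, so the induction needs the product and sum rules and a middle
space of finite dimension. *)
Lemma Ck_comp_scalar k U (U' : set 'rV[R]_n) f (g : 'rV[R]_n -> R^o) :
  open U -> open U' -> (forall x, U x -> U' (f x)) ->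
  Ck k U f -> Ck k U' g -> Ck k U (fun x => g (f x)).
Proof.
move=> oU oU' fU; elim: k g => [|k IH] g Hf0 Hg0.
  by move=> x Ux; apply: continuous_comp; [exact: Hf0|apply: Hg0; exact: fU].
have Hf1 := Ck_pred Hf0; move: Hf0 Hg0 => [Hf Hf'] [Hg Hg']; split=> [x Ux|v].
  by apply: differentiable_comp; [exact: Hf|apply: Hg; exact: fU].
have H j := CkM oU (Ck_coord j oU (Hf' v)) (IH _ Hf1 (Hg' (delta_mx 0 j))).
apply: (Ck_ext oU _ (Ck_sum (index_enum _) (P := xpredT) oU (fun j _ => H j))).
move=> x Ux; have dg := Hg _ (fU x Ux); have df := Hf _ Ux.
by rewrite (derive_comp v df dg) (derive_dir_sum _ dg).
Qed.

Lemma derive_row f x v : differentiable f x ->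
  'D_v f x = \row_j 'D_v (fun y => f y 0 j : R^o) x.
Proof.
move=> df; rewrite derive_mx; last exact: diff_derivable.
by apply/rowP => j; rewrite !mxE.
Qed.

End CkRow.

Lemma Ck_comp (R : realType) (V : normedModType R) (n l k : nat) (U : set V)
    (U' : set 'rV[R]_n) (f : V -> 'rV[R]_n) (g : 'rV[R]_n -> 'rV[R]_l) :
  open U -> open U' -> (forall x, U x -> U' (f x)) ->
  Ck k U f -> Ck k U' g -> Ck k U (fun x => g (f x)).
Proof.
move=> oU oU' fU Hf Hg; apply: Ck_row => // j.
exact: (Ck_comp_scalar (g := fun y => g y 0 j) oU oU' fU Hf (Ck_coord j oU' Hg)).
Qed.

Section CkMatrix.
Context {R : realType} {V : normedModType R}.
Implicit Types (U : set V).

Lemma Ck_det k U n (A : V -> 'M[R]_n) : open U ->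
  (forall i j, Ck k U (fun x => A x i j : R^o)) ->
  Ck k U (fun x => \det (A x) : R^o).
Proof.
move=> oU HA.
have Hs (s : {perm 'I_n}) :
    Ck k U (fun x => (-1) ^+ s * \prod_i A x i (s i) : R^o).
  apply: CkM => //; first exact: Ck_cst.
  exact: (Ck_prod (index_enum _) oU (fun i => HA i (s i))).
exact: (Ck_ext oU _ (Ck_sum (index_enum _) (P := xpredT) oU (fun s _ => Hs s))).
Qed.

(** Cramer's rule. *)
Lemma Ck_invmx k U n (A : V -> 'M[R]_n) : open U ->
  (forall x, U x -> A x \in unitmx) ->
  (forall i j, Ck k U (fun x => A x i j : R^o)) ->
  forall i j, Ck k U (fun x => invmx (A x) i j : R^o).
Proof.
move=> oU uA HA i j.
have Hcof : Ck k U (fun x => cofactor (A x) j i : R^o).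
  apply: CkM => //; first exact: Ck_cst.
  apply: Ck_det => // a b.
  by apply: (Ck_ext oU _ (HA (lift j a) (lift i b))) => x _; rewrite !mxE.
have Hdet : Ck k U (fun x => (\det (A x))^-1 : R^o).
  apply: CkV => //; last exact: Ck_det.
  by move=> x Ux; rewrite -unitfE -unitmxE uA.
apply: (Ck_ext oU _ (CkM oU Hdet Hcof)) => x Ux.
by rewrite /invmx uA // !mxE.
Qed.

Lemma Ck_mulmx k U n (r : V -> 'rV[R]_n) (A : V -> 'M[R]_n) : open U ->
  Ck k U r -> (forall i j, Ck k U (fun x => A x i j : R^o)) ->
  Ck k U (fun x => r x *m A x).
Proof.
move=> oU Hr HA; apply: Ck_row => // j.
apply: (Ck_ext oU _ (Ck_sum (index_enum _) (P := xpredT) oU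
  (fun i _ => CkM oU (Ck_coord i oU Hr) (HA i j)))) => x _.
by rewrite mxE.
Qed.

End CkMatrix.

(** * A smooth bump function *)

Section Bump.
Context {R : realType}.

(** The factor t^-n is there to make the family stable under differentiation, see
[is_derive_flatexp]; n = 0 is the usual flat function. *)
Definition flatexp n (t : R^o) : R^o :=
  if 0 < t then expR (- t^-1) * t^-1 ^+ n else 0.

(** Comes from e^u >= u^(n+2) / (n+2)! at u = 1/t; it forces a vanishing derivative
at 0. *)
Lemma flatexp_le n t : `|flatexp n t| <= n.+2`!%:R * t ^+ 2.
Proof.
rewrite /flatexp; case: ifPn => [t0|_]; last first.
  by rewrite normr0 mulr_ge0 // sqr_ge0.
rewrite ger0_norm; last first.
  by rewrite mulr_ge0 ?expR_ge0 // exprn_ge0 // invr_ge0 ltW.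
have := @expR_ge1Dxn R t^-1 n.+1; rewrite invr_ge0 ltW // => /(_ isT) H.
rewrite expRN mulrC -ler_pdivlMr ?invr_gt0 ?expR_gt0 // invrK.
have f0 : 0 < (n.+2`!%:R : R) by rewrite ltr0n fact_gt0.
have {}H : t^-1 ^+ n.+2 <= n.+2`!%:R * expR t^-1.
  by rewrite mulrC -ler_pdivrMr //; apply: le_trans H; rewrite lerDr.
rewrite mulrAC -ler_pdivrMr ?exprn_gt0 // -exprVn mulrC -exprD.
exact: H.
Qed.

Lemma flatexp_gt0 t : 0 < t -> 0 < flatexp 0 t.
Proof. by move=> t0; rewrite /flatexp t0 expr0 mulr1 expR_gt0. Qed.

Lemma flatexp_le0 n t : t <= 0 -> flatexp n t = 0.
Proof. by rewrite leNgt /flatexp => /negbTE ->. Qed.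

Lemma is_derive_flatexp n (t : R^o) :
  is_derive (t : R^o) (1 : R^o) (flatexp n) (flatexp n.+2 t - (n%:R : R) * flatexp n.+1 t).
Proof.
have [t0|t0|->] := ltgtP t 0.
- rewrite !(flatexp_le0 _ (ltW t0)) mulr0 subrr.
  have c0 : is_derive t (1 : R^o) (cst (0 : R^o)) 0 by exact: is_derive_cst.
  apply: (near_eq_is_derive _ c0).
  have tn : \forall s \near t, s < 0 := lt_nbhsl t0.
  by apply: filterS tn => s s0; rewrite flatexp_le0 // ltW.
- rewrite {2 3}/flatexp t0.
  have tn0 : t != 0 by rewrite gt_eqF.
  have dI := @is_deriveV R id t (1 : R) 1 tn0 (is_derive_id _ _).
  have dE : is_derive (t^-1) 1 (fun u : R => expR (- u)) (- expR (- t^-1)).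
    have := @is_derive1_comp R expR -%R t^-1 _ _ (is_derive_expR _) (is_deriveNid _ _).
    by rewrite mulrN1.
  have dX := is_deriveX n (is_derive_id (t^-1 : R) (1 : R)).
  have := is_derive1_comp (is_deriveM dE dX) dI.
  move=> dc; apply: (near_eq_is_derive _ (is_derive_eq dc _)).
    have tn : \forall s \near t, 0 < s := lt_nbhsr t0.
    by apply: filterS tn => s s0; rewrite /flatexp s0 /= !(exprfctE, fctE).
  rewrite /GRing.scale /= !mulr1 -exprVn; set u := t^-1.
  rewrite !(exprfctE, fctE) /=.
  case: (n) => [|k] /=; rewrite ?expr0 ?mul0r ?mulr0 ?add0r ?subr0 ?mul1r.
    by rewrite mulrNN.
  by rewrite !exprS; ring.
- rewrite !flatexp_le0 // mulr0 subrr.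
  have cv : (fun h : R => h^-1 *: (flatexp n (h *: 1 + 0) - flatexp n 0)) @ 0^'
      --> (0 : R^o).
    apply/cvgrPdist_le => e e0; near=> h.
    rewrite sub0r normrN addr0 (flatexp_le0 _ (lexx 0)) subr0.
    rewrite /GRing.scale /= mulr1 normrM normfV.
    have h0 : 0 < `|h| by rewrite normr_gt0; near: h; exact: nbhs_dnbhs_neq.
    rewrite ler_pdivrMl //; apply: le_trans (flatexp_le n h) _.
    rewrite -real_normK ?num_real // expr2 mulrCA ler_pM2l //.
    rewrite -ler_pdivlMl ?ltr0n ?fact_gt0 //.
    near: h; apply: dnbhs0_le.
    by rewrite mulr_gt0 // invr_gt0 ltr0n fact_gt0.
  apply: DeriveDef; first by apply/cvg_ex; exists 0.
  by rewrite /derive; apply: cvg_lim.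
Unshelve. all: by end_near. Qed.

(** Since the derivative of [flatexp n] is again a combination of such functions,
an induction on k with n universally quantified suffices. *)
Lemma Ck_flatexp (V : normedModType R) k n (U : set V) (s : V -> R^o) :
  open U -> Ck k U s -> Ck k U (fun x => flatexp n (s x)).
Proof.
have df m (t : R^o) : differentiable (flatexp m) t.
  by apply/derivable1_diffP; have [] := is_derive_flatexp m t.
move=> oU; elim: k n => [|k IH] n Hs.
  move=> x Ux; apply: continuous_comp; first exact: Hs.
  by apply: differentiable_continuous; exact: df.
have Hs1 := Ck_pred Hs; case: Hs => ds Hs'; split=> [x Ux|v].
  by apply: differentiable_comp; [exact: ds|exact: df].
have H := CkM oU (CkD oU (IH n.+2 Hs1) (CkM oU (Ck_cst k U (- n%:R : R^o)) (IH n.+1 Hs1)))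
  (Hs' v).
apply: (Ck_ext oU _ H) => x Ux; apply/esym.
rewrite (derive_comp v (ds x Ux) (df n (s x))).
rewrite deriveE; last exact: df.
rewrite -['D_v s x]mulr1 -['D_v s x * 1]/('D_v s x *: (1 : R^o)) linearZ /=.
rewrite -deriveE; last exact: df.
have [_ ->] := is_derive_flatexp n (s x).
by rewrite /GRing.scale /= mulr1 [RHS]mulrC mulNr.
Qed.

Definition sqdist m (x y : 'rV[R]_m) : R^o := \sum_i (y 0 i - x 0 i) ^+ 2.

(** The Euclidean distance is used because the norm of row vectors is the sup norm,
which is not smooth. *)
Definition bump m (x : 'rV[R]_m) (r : R) (y : 'rV[R]_m) : R^o :=
  flatexp 0 (r ^+ 2 - sqdist x y).

Lemma Ck_id k m (U : set 'rV[R]_m) : open U -> Ck k U (fun x => x).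
Proof.
case: k => [|k] oU; first by move=> x _.
split=> [x _|v].
  by have [] := @is_diff_id R 'rV[R]_m x.
by apply: (Ck_ext oU _ (Ck_cst k U v)) => x _; rewrite derive_id.
Qed.

Lemma Ck_bump k m (x : 'rV[R]_m) r (U : set 'rV[R]_m) : open U ->
  Ck k U (bump x r).
Proof.
move=> oU; have Hsq : Ck k U (sqdist x).
  have Hi i : Ck k U (fun y : 'rV[R]_m => (y 0 i - x 0 i) ^+ 2 : R^o).
    apply: CkX => //; apply: CkD => //; last exact: Ck_cst.
    by apply: Ck_coord => //; exact: Ck_id.
  exact: (Ck_sum (index_enum _) (P := xpredT) oU (fun i _ => Hi i)).
have H : Ck k U (fun y => r ^+ 2 - sqdist x y : R^o).
  by apply: CkD => //; [exact: Ck_cst|exact: CkN].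
exact: Ck_flatexp.
Qed.

Lemma bump_gt0 m (x : 'rV[R]_m) r : 0 < r -> 0 < bump x r x.
Proof.
move=> r0; apply: flatexp_gt0; rewrite /sqdist big1 ?subr0 ?exprn_gt0 // => i _.
by rewrite subrr expr0n.
Qed.

Lemma bump_supp m (x y : 'rV[R]_m) r : 0 < r -> bump x r y != 0 ->
  closed_ball x r y.
Proof.
move=> r0; case: (ltP (sqdist x y) (r ^+ 2)) => [lt _|le]; last first.
  by rewrite /bump flatexp_le0 ?eqxx // subr_le0.
rewrite closed_ballE // /closed_ball_ /= /Num.Def.normr /= mx_normrE.
apply: bigmax_le => [|[i j] _]; first exact: ltW.
rewrite /= ord1 -(ger0_norm (ltW r0)) -ler_sqr ?nnegrE ?normr_ge0 //.
rewrite !real_normK ?num_real //; apply: le_trans (ltW lt).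
rewrite /sqdist (bigD1 j) //= !mxE -sqrrN opprB lerDl.
by apply: sumr_ge0 => k _; exact: sqr_ge0.
Qed.

End Bump.

(** * Product rules for pairings *)

Section Calc.
Context {R : realType} {V : normedModType R} {m : nat}.

Lemma differentiable_row (f : V -> 'rV[R]_m) x :
  differentiable f x -> forall j, differentiable (fun y => f y 0 j : R^o) x.
Proof.
move=> df j.
exact: (@differentiable_comp _ _ _ _ f (fun N : 'rV[R]_m => N 0 j : R) x df
  (differentiable_coord _ _ _)).
Qed.

Lemma evE (a u : 'rV[R]_m) : ev a u = \sum_j a 0 j * u 0 j.
Proof. by rewrite /ev mxE; apply: eq_bigr => j _; rewrite mxE. Qed.

Lemma bilE (b : 'M[R]_m) u v : bil b u v = ev (u *m b) v.
Proof. by []. Qed.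

Lemma derive_ev (a u : V -> 'rV[R]_m) x w :
  (forall j, differentiable (fun y => a y 0 j : R^o) x) ->
  (forall j, differentiable (fun y => u y 0 j : R^o) x) ->
  'D_w (fun y => ev (a y) (u y) : R^o) x =
  ev (\row_j 'D_w (fun y => a y 0 j : R^o) x) (u x) +
  ev (a x) (\row_j 'D_w (fun y => u y 0 j : R^o) x).
Proof.
move=> da du; have E : (fun y => ev (a y) (u y) : R^o) =
    \sum_j (fun y => a y 0 j * u y 0 j : R^o).
  by apply/funext => y; rewrite evE fct_sumE.
rewrite E derive_sum; last first.
  by move=> j; apply: derivableM; apply: diff_derivable.
rewrite !evE -big_split; apply: eq_bigr => j _ /=.
rewrite !mxE.
have -> := deriveM (@diff_derivable _ _ _ _ _ w (da j)) (@diff_derivable _ _ _ _ _ w (du j)).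
by rewrite addrC; congr (_ + _); rewrite [LHS]mulrC.
Qed.

Lemma differentiable_ev (a u : V -> 'rV[R]_m) x :
  (forall j, differentiable (fun y => a y 0 j : R^o) x) ->
  (forall j, differentiable (fun y => u y 0 j : R^o) x) ->
  differentiable (fun y => ev (a y) (u y) : R^o) x.
Proof.
move=> da du; have -> : (fun y => ev (a y) (u y) : R^o) =
    \sum_j (fun y => a y 0 j * u y 0 j : R^o).
  by apply/funext => y; rewrite evE fct_sumE.
by apply: differentiable_sum => j; exact: differentiableM.
Qed.

Lemma derive_bil (B : V -> 'M[R]_m) (u v : V -> 'rV[R]_m) x w :
  (forall i j, differentiable (fun y => B y i j : R^o) x) ->
  (forall j, differentiable (fun y => u y 0 j : R^o) x) ->
  (forall j, differentiable (fun y => v y 0 j : R^o) x) ->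
  'D_w (fun y => bil (B y) (u y) (v y) : R^o) x =
  bil (\matrix_(i, j) 'D_w (fun y => B y i j : R^o) x) (u x) (v x) +
  bil (B x) (\row_j 'D_w (fun y => u y 0 j : R^o) x) (v x) +
  bil (B x) (u x) (\row_j 'D_w (fun y => v y 0 j : R^o) x).
Proof.
move=> dB du dv.
have E j : (fun y => (u y *m B y) 0 j : R^o) =
    (fun y => ev (u y) (\row_i B y i j)).
  by apply/funext => y; rewrite mxE evE; apply: eq_bigr => i _; rewrite mxE.
have Ei i j : (fun y => (\row_i B y i j) 0 i : R^o) = (fun y => B y i j : R^o).
  by apply/funext => y; rewrite mxE.
have dBr j i : differentiable (fun y => (\row_i B y i j) 0 i : R^o) x.
  by rewrite Ei.
rewrite (@derive_ev (fun y => u y *m B y)) //; last first.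
  by move=> j; rewrite E; exact: differentiable_ev.
rewrite [in RHS]bilE [X in _ + X + _]bilE; congr (_ + _).
rewrite !evE -big_split; apply: eq_bigr => j _ /=.
rewrite -mulrDl; congr (_ * _).
rewrite mxE E derive_ev // addrC; congr (_ + _).
  rewrite mxE evE; apply: eq_bigr => i _; rewrite !mxE.
  by rewrite Ei.
rewrite mxE evE; apply: eq_bigr => i _.
by rewrite !mxE.
Qed.

End Calc.

(** * Tangent vectors in charts *)

Section Charts.
Context {R : realType} {m : nat} {M : smoothManifold R m}.
Implicit Types (c : chart R m M) (q p : M) (W : set M).

Lemma chart_mem c W q : cdom c q -> W q -> (c @` (cdom c `&` W)) (c q).
Proof. by move=> cq Wq; exists q. Qed.

Lemma chart_image_open c W : open W -> open (c @` (cdom c `&` W)).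
Proof.
move=> oW; rewrite openE => _ [p [cp Wp] <-].
have ic : (c @` cdom c) (c p) by exists p.
have H1 : \forall x \near c p, (c @` cdom c) x.
  by apply: open_nbhs_nbhs; split => //; exact: cimg_open.
have H2 : \forall x \near c p, W (cinv c x).
  apply: (cinv_cont ic); rewrite cmapK //.
  by apply: open_nbhs_nbhs; split.
change (\forall x \near c p, (c @` (cdom c `&` W)) x).
apply: filterS2 H1 H2 => x [q cq <-]; rewrite cmapK // => Wq.
by exists q.
Qed.

Lemma chart_near c W q : open W -> cdom c q -> W q ->
  \forall x \near c q, (c @` (cdom c `&` W)) x.
Proof.
move=> oW cq Wq; apply: open_nbhs_nbhs; split; first exact: chart_image_open.
exact: chart_mem.
Qed.

Definition trans c c' : 'rV[R]_m -> 'rV[R]_m := c' \o cinv c.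

Lemma trans_differentiable c c' q : atlas c -> atlas c' ->
  cdom c q -> cdom c' q -> differentiable (trans c c') (c q).
Proof.
move=> ac ac' cq c'q; have [H _] := atlas_compat ac ac' 1%N.
by apply: H; exact: chart_mem.
Qed.

(** All the facts on components of vectors below are instances of this cocycle
rule, with the preferred chart at q in one of the three places. *)
Lemma trans_chain c1 c2 c3 q v : atlas c1 -> atlas c2 -> atlas c3 ->
  cdom c1 q -> cdom c2 q -> cdom c3 q ->
  'D_('D_v (trans c1 c2) (c1 q)) (trans c2 c3) (c2 q) = 'D_v (trans c1 c3) (c1 q).
Proof.
move=> a1 a2 a3 q1 q2 q3.
have d12 := trans_differentiable a1 a2 q1 q2.
have d23 := trans_differentiable a2 a3 q2 q3.
have e : trans c1 c2 (c1 q) = c2 q by rewrite /trans /= cmapK.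
rewrite -e in d23 *; rewrite -(derive_comp v d12 d23).
apply: near_eq_derive.
have := chart_near (cdom_open c2) q1 q2; apply: filterS => _ [q' [q1' q2'] <-].
by rewrite /trans /= !cmapK.
Qed.

Lemma trans_id c q v : cdom c q -> 'D_v (trans c c) (c q) = v.
Proof.
move=> cq; rewrite -[RHS](derive_id (c q) v); apply: near_eq_derive.
have := chart_near openT cq I; apply: filterS => _ [q' [q1' _] <-].
by rewrite /trans /= !cmapK.
Qed.

Lemma coords_transE c q v : coords c q v = 'D_v (trans (chart_at q) c) (chart_at q q).
Proof. by []. Qed.

Lemma tvec_transE c q v : tvec c q v = 'D_v (trans c (chart_at q)) (c q).
Proof. by []. Qed.

Lemma tvecK c q u : atlas c -> cdom c q -> coords c q (tvec c q u) = u.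
Proof.
move=> ac cq; rewrite coords_transE tvec_transE trans_chain ?trans_id //.
- exact: chart_at_atlas.
- exact: chart_at_dom.
Qed.

Lemma coordsK c q v : atlas c -> cdom c q -> tvec c q (coords c q v) = v.
Proof.
move=> ac cq; rewrite coords_transE tvec_transE trans_chain ?trans_id //;
  by [exact: chart_at_atlas|exact: chart_at_dom].
Qed.

Lemma coords_trans c c' q v : atlas c -> atlas c' -> cdom c q -> cdom c' q ->
  coords c' q v = 'D_(coords c q v) (trans c c') (c q).
Proof.
move=> ac ac' cq c'q; rewrite !coords_transE trans_chain //;
  by [exact: chart_at_atlas|exact: chart_at_dom].
Qed.

Lemma coords_tvec c c' q u : atlas c -> atlas c' -> cdom c q -> cdom c' q ->
  coords c' q (tvec c q u) = 'D_u (trans c c') (c q).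
Proof. by move=> ac ac' cq c'q; rewrite (coords_trans _ ac ac' cq c'q) (tvecK _ ac cq). Qed.

Lemma coords_at p v : coords (chart_at p) p v = v.
Proof. by rewrite coords_transE trans_id //; exact: chart_at_dom. Qed.

Lemma tvec_at p v : tvec (chart_at p) p v = v.
Proof. by rewrite tvec_transE trans_id //; exact: chart_at_dom. Qed.

Definition coords_mx c q : 'M[R]_m := \matrix_i coords c q (bvec i).
Definition tvec_mx c q : 'M[R]_m := \matrix_i tvec c q (bvec i).

Lemma derive_dir_mx (g : 'rV[R]_m -> 'rV[R]_m) y w : differentiable g y ->
  'D_w g y = w *m \matrix_i 'D_(delta_mx 0 i) g y.
Proof.
move=> dg; rewrite derive_dir_sum // mulmx_sum_row; apply: eq_bigr => i _.
by rewrite rowK.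
Qed.

Lemma coordsE c q v : atlas c -> cdom c q -> coords c q v = v *m coords_mx c q.
Proof.
move=> ac cq; rewrite coords_transE derive_dir_mx //.
by apply: trans_differentiable => //; [exact: chart_at_atlas|exact: chart_at_dom].
Qed.

Lemma tvecE c q v : atlas c -> cdom c q -> tvec c q v = v *m tvec_mx c q.
Proof.
move=> ac cq; rewrite tvec_transE derive_dir_mx //.
by apply: trans_differentiable => //; [exact: chart_at_atlas|exact: chart_at_dom].
Qed.

Lemma tvec_mx_coords_mx c q : atlas c -> cdom c q -> tvec_mx c q *m coords_mx c q = 1%:M.
Proof.
move=> ac cq; apply/row_matrixP => i.
by rewrite row_mul rowK -coordsE // tvecK // row1.
Qed.

Lemma coords_mx_tvec_mx c q : atlas c -> cdom c q -> coords_mx c q *m tvec_mx c q = 1%:M.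
Proof. by move=> ac cq; apply/mulmx1C/tvec_mx_coords_mx. Qed.

(** Components of a bilinear form in the frame of the chart c; unlike b q itself,
they vary smoothly with q when b is smooth. *)
Definition form_comp (b : M -> 'M[R]_m) c q : 'M[R]_m :=
  tvec_mx c q *m b q *m (tvec_mx c q)^T.

Definition cov_comp (a : covfield M) c q : 'rV[R]_m := a q *m (tvec_mx c q)^T.

Lemma bil_tvec b c q u v : atlas c -> cdom c q ->
  bil (b q) (tvec c q u) (tvec c q v) = bil (form_comp b c q) u v.
Proof.
by move=> ac cq; rewrite !tvecE // /bil /form_comp trmx_mul !mulmxA.
Qed.

Lemma bil_form_comp b c q u v : atlas c -> cdom c q ->
  bil (b q) u v = bil (form_comp b c q) (coords c q u) (coords c q v).
Proof. by move=> ac cq; rewrite -(bil_tvec b _ _ ac cq) !(coordsK _ ac cq). Qed.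

Lemma ev_tvec a c q u : atlas c -> cdom c q ->
  ev (a q) (tvec c q u) = ev (cov_comp a c q) u.
Proof. by move=> ac cq; rewrite tvecE // /ev /cov_comp trmx_mul !mulmxA. Qed.

Lemma ev_cov_comp a c q u : atlas c -> cdom c q ->
  ev (a q) u = ev (cov_comp a c q) (coords c q u).
Proof. by move=> ac cq; rewrite -ev_tvec // coordsK. Qed.

Lemma bil_bvec (b : 'M[R]_m) i j : bil b (bvec i) (bvec j) = b i j.
Proof.
rewrite /bil -rowE mxE (bigD1 j) //= big1 ?addr0; last first.
  by move=> k kj; rewrite !mxE (negbTE kj) andbF mulr0.
by rewrite !mxE !eqxx mulr1.
Qed.

Lemma ev_bvec (a : 'rV[R]_m) i : ev a (bvec i) = a 0 i.
Proof.
rewrite /ev mxE (bigD1 i) //= big1 ?addr0; last first.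
  by move=> k kj; rewrite !mxE (negbTE kj) andbF mulr0.
by rewrite !mxE !eqxx mulr1.
Qed.

End Charts.
Arguments chart_image_open {R m M} c {W}.

(** * Smooth functions, fields and forms *)

Section SmoothTensors.
Context {R : realType} {m : nat} {M : smoothManifold R m}.
Implicit Types (c : chart R m M) (q p : M) (W : set M) (f g : M -> R).
Implicit Types (X Y : vecfield M) (a : covfield M) (b : M -> 'M[R]_m).

Definition smooth_fun_on W f := @chartwise_smooth R m M R^o W (fun=> f).

Lemma chartwise_ext (V : normedModType R) W (f g : chart R m M -> M -> V) :
  open W -> (forall c q, atlas c -> cdom c q -> W q -> f c q = g c q) ->
  chartwise_smooth W f -> chartwise_smooth W g.
Proof.
move=> oW fg Hf c ac k.
have := Hf c ac k; apply: Ck_ext; first exact: chart_image_open.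
by move=> _ [q [cq Wq] <-]; rewrite /= cmapK // fg.
Qed.

Lemma chartwise_sub (V : normedModType R) W W' (f : chart R m M -> M -> V) :
  W' `<=` W -> chartwise_smooth W f -> chartwise_smooth W' f.
Proof.
move=> sW Hf c ac k; apply: Ck_sub (Hf c ac k).
by move=> _ [q [cq /sW Wq] <-]; exists q.
Qed.

Lemma chartwise_local (V : normedModType R) (f : chart R m M -> M -> V) :
  (forall p, exists2 W, W p & chartwise_smooth W f) -> chartwise_smooth setT f.
Proof.
move=> H c ac k; apply: Ck_local => _ [p [cp _] <-].
by have [W Wp /(_ c ac k)] := H p; apply: Ck_sub => _ ->; exact: chart_mem.
Qed.

Lemma smooth_funD W f g : open W -> smooth_fun_on W f -> smooth_fun_on W g ->
  smooth_fun_on W (fun q => f q + g q).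
Proof.
move=> oW Hf Hg c ac k.
have := CkD (chart_image_open c oW) (Hf c ac k) (Hg c ac k).
by apply: Ck_ext => //; exact: chart_image_open.
Qed.

Lemma smooth_funM W f g : open W -> smooth_fun_on W f -> smooth_fun_on W g ->
  smooth_fun_on W (fun q => f q * g q).
Proof.
move=> oW Hf Hg c ac k.
have := CkM (chart_image_open c oW) (Hf c ac k) (Hg c ac k).
by apply: Ck_ext => //; exact: chart_image_open.
Qed.

Lemma smooth_funN W f : open W -> smooth_fun_on W f ->
  smooth_fun_on W (fun q => - f q).
Proof.
move=> oW Hf c ac k; have := CkN (chart_image_open c oW) (Hf c ac k).
by apply: Ck_ext => //; exact: chart_image_open.
Qed.

Lemma smooth_fun_cst W (r : R) : smooth_fun_on W (fun=> r).
Proof. by move=> c ac k; exact: Ck_cst. Qed.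

Lemma Ck_ev (V : normedModType R) k (U : set V) (a u : V -> 'rV[R]_m) :
  open U -> Ck k U a -> Ck k U u -> Ck k U (fun x => ev (a x) (u x) : R^o).
Proof.
move=> oU Ha Hu; apply: (Ck_ext oU _ (Ck_sum (index_enum _) (P := xpredT) oU
  (fun j _ => CkM oU (Ck_coord j oU Ha) (Ck_coord j oU Hu)))) => x _.
by rewrite evE.
Qed.

Lemma smooth_covP W a : open W -> smooth_cov W a <->
  chartwise_smooth W (fun c q => cov_comp a c q).
Proof.
move=> oW; split=> H.
  move=> c ac k; have oU := chart_image_open c oW.
  apply: Ck_row => // j; apply: (Ck_ext oU _ (H (bvec j) c ac k)).
  by move=> _ [q [cq Wq] <-]; rewrite /= cmapK // ev_tvec // ev_bvec.
move=> u; have H' : chartwise_smooth W (fun c q => ev (cov_comp a c q) u : R^o).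
  move=> c ac k; have oU := chart_image_open c oW.
  exact: (Ck_ev oU (H c ac k) (Ck_cst _ _ u)).
by apply: chartwise_ext H' => // c q ac cq _; rewrite ev_tvec.
Qed.

Lemma smooth_form_comp W b : open W -> smooth_bil b -> forall i j,
  chartwise_smooth W (fun c q => form_comp b c q i j : R^o).
Proof.
move=> oW Hb i j.
apply: chartwise_ext (chartwise_sub (subsetT W) (Hb (bvec i) (bvec j))) => //.
by move=> c q ac cq _; rewrite bil_tvec // bil_bvec.
Qed.

Lemma smooth_ev W a X : open W -> smooth_cov W a -> smooth_vec W X ->
  smooth_fun_on W (fun q => ev (a q) (X q)).
Proof.
move=> oW /(smooth_covP _ oW) Ha HX.
have H : chartwise_smooth W (fun c q => ev (cov_comp a c q) (coords c q (X q)) : R^o).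
  move=> c ac k; have oU := chart_image_open c oW.
  exact: (Ck_ev oU (Ha c ac k) (HX c ac k)).
by apply: chartwise_ext H => // c q ac cq _; rewrite -ev_cov_comp.
Qed.

Lemma cov_comp_flat b X c q : atlas c -> cdom c q ->
  cov_comp (fun q => flat (b q) (X q)) c q = coords c q (X q) *m form_comp b c q.
Proof.
move=> ac cq; rewrite /cov_comp /form_comp /flat (coordsE _ ac cq) !mulmxA.
by rewrite -(mulmxA (X q) (coords_mx c q) (tvec_mx c q)) (coords_mx_tvec_mx ac cq) mulmx1.
Qed.

Lemma smooth_flat W b X : open W -> smooth_bil b -> smooth_vec W X ->
  smooth_cov W (fun q => flat (b q) (X q)).
Proof.
move=> oW Hb HX; apply/(smooth_covP _ oW).
have H : chartwise_smooth W (fun c q => coords c q (X q) *m form_comp b c q).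
  move=> c ac k; have oU := chart_image_open c oW.
  exact: (Ck_mulmx oU (HX c ac k) (fun i j => smooth_form_comp oW Hb i j ac k)).
by apply: chartwise_ext H => // c q ac cq _; rewrite cov_comp_flat.
Qed.

Lemma smooth_bilf W b X Y : open W -> smooth_bil b -> smooth_vec W X ->
  smooth_vec W Y -> smooth_fun_on W (fun q => bil (b q) (X q) (Y q)).
Proof. by move=> oW Hb HX; apply: smooth_ev => //; exact: smooth_flat. Qed.

Lemma smooth_vecD W X Y : open W -> smooth_vec W X -> smooth_vec W Y ->
  smooth_vec W (fun q => X q + Y q).
Proof.
move=> oW HX HY.
have H : chartwise_smooth W (fun c q => coords c q (X q) + coords c q (Y q)).
  by move=> c ac k; exact: (CkD (chart_image_open c oW) (HX c ac k) (HY c ac k)).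
by apply: chartwise_ext H => // c q ac cq _; rewrite !coordsE // mulmxDl.
Qed.

Lemma smooth_vecZ W f X : open W -> smooth_fun_on W f -> smooth_vec W X ->
  smooth_vec W (fun q => f q *: X q).
Proof.
move=> oW Hf HX.
have H : chartwise_smooth W (fun c q => f q *: coords c q (X q)).
  move=> c ac k; have oU := chart_image_open c oW.
  apply: Ck_row => // j.
  apply: (Ck_ext oU _ (CkM oU (Hf c ac k) (Ck_coord j oU (HX c ac k)))).
  by move=> x _; rewrite mxE.
by apply: chartwise_ext H => // c q ac cq _; rewrite !coordsE // scalemxAl.
Qed.

Lemma smooth_vecB W X Y : open W -> smooth_vec W X -> smooth_vec W Y ->
  smooth_vec W (fun q => X q - Y q).
Proof.
move=> oW HX HY.
have H := smooth_vecD oW HX (smooth_vecZ oW (smooth_fun_cst W (-1)) HY).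
by apply: (chartwise_ext oW _ H) => c q _ _ _; rewrite scaleN1r.
Qed.

Lemma smooth_covD W a a' : open W -> smooth_cov W a -> smooth_cov W a' ->
  smooth_cov W (fun q => a q + a' q).
Proof.
move=> oW Ha Ha' u.
have H : chartwise_smooth W (fun c q =>
    ev (a q) (tvec c q u) + ev (a' q) (tvec c q u) : R^o).
  by move=> c ac k; exact: (CkD (chart_image_open c oW) (Ha u c ac k) (Ha' u c ac k)).
apply: (chartwise_ext (V := R^o) oW _ H) => c q ac cq _.
by rewrite /ev mulmxDl [RHS]mxE.
Qed.

Lemma smooth_covN W a : open W -> smooth_cov W a ->
  smooth_cov W (fun q => - a q).
Proof.
move=> oW Ha u.
have H : chartwise_smooth W (fun c q => - ev (a q) (tvec c q u) : R^o).
  by move=> c ac k; exact: (CkN (chart_image_open c oW) (Ha u c ac k)).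
apply: (chartwise_ext (V := R^o) oW _ H) => c q ac cq _.
by rewrite /ev mulNmx [RHS]mxE.
Qed.

Lemma tvec_mx_unit c q : atlas c -> cdom c q -> tvec_mx c q \in unitmx.
Proof. by move=> ac cq; case: (mulmx1_unit (tvec_mx_coords_mx ac cq)). Qed.

(** In the frame of a chart, raising an index is multiplication by the inverse of the
matrix of components of b. *)
Lemma smooth_sharp W b a : open W -> smooth_bil b ->
  (forall q, b q \in unitmx) -> smooth_cov W a ->
  smooth_vec W (fun q => sharp (b q) (a q)).
Proof.
move=> oW Hb ub /(smooth_covP _ oW) Ha.
have ul c q : atlas c -> cdom c q -> form_comp b c q \in unitmx.
  by move=> ac cq; rewrite !unitmx_mul unitmx_tr tvec_mx_unit // ub.
have H : chartwise_smooth W (fun c q => cov_comp a c q *m invmx (form_comp b c q)).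
  move=> c ac k; have oU := chart_image_open c oW.
  apply: (Ck_mulmx oU (Ha c ac k)).
  apply: (Ck_invmx (A := fun x => form_comp b c (cinv c x)) oU).
    by move=> _ [q [cq Wq] <-]; rewrite cmapK // ul.
  by move=> i j; exact: smooth_form_comp ac k.
apply: chartwise_ext H => // c q ac cq _.
rewrite (coordsE _ ac cq) /sharp.
apply: (can_inj (mulmxK (ul c q ac cq))); rewrite (mulmxKV (ul c q ac cq)).
rewrite /form_comp !mulmxA -(mulmxA _ (coords_mx c q) (tvec_mx c q)) (coords_mx_tvec_mx ac cq) mulmx1.
by rewrite (mulmxKV (ub q)).
Qed.

Lemma dir_differentiable f p : smooth_fun_on setT f ->
  differentiable (f \o cinv (chart_at p) : _ -> R^o) (chart_at p p).
Proof.
move=> Hf; have [H _] := Hf _ (chart_at_atlas p) 1%N.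
by apply: H; apply: chart_mem => //; exact: chart_at_dom.
Qed.

End SmoothTensors.

(** * Extension of chart fields to the whole manifold *)

Section Cutoff.
Context {R : realType} {m : nat} {M : smoothManifold R m}.
Implicit Types (c : chart R m M) (q p : M).

Lemma compact_closed_ball (x : 'rV[R]_m) (r : R) :
  0 < r -> compact (closed_ball x r).
Proof.
move=> r0; apply: bounded_closed_compact; last exact: closed_ball_closed.
rewrite closed_ballE //; exists (`|x| + r); split; first exact: num_real.
move=> M' HM y /= xy; apply: le_trans (ltW HM).
rewrite -(subrK x y) addrC; apply: le_trans (ler_normD _ _) _.
by rewrite lerD2l distrC.
Qed.

(** The support of the bump function is a compact set in the image of the chart; its
preimage K in M is compact, hence closed because M is Hausdorff.  So a field
supported in K is smooth at the points outside the domain of c as well. *)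
Lemma smooth_cutoff c p : atlas c -> cdom c p ->
  exists chi : M -> R, [/\ 0 < chi p,
    @smooth_on R _ R^o (c @` (cdom c `&` setT)) (chi \o cinv c) &
    forall u, smooth_vec setT (fun q => chi q *: tvec c q u)].
Proof.
move=> ac cp.
have : nbhs (c p) (c @` cdom c).
  by apply: open_nbhs_nbhs; split; [exact: cimg_open|exists p].
move=> /nbhs_closedballP[r sub].
set B := closed_ball (c p) r%:num in sub.
pose K := cinv c @` B.
have cK : compact K.
  apply: continuous_compact; last exact: compact_closed_ball.
  apply: continuous_in_subspaceT => x; rewrite inE => Bx.
  by apply: cinv_cont; exact: sub.
have clK : closed K by apply: compact_closed cK; exact: carrier_hausdorff.
have Kdom q : K q -> cdom c q.
  by move=> [_ /sub[q' cq' <-] <-]; rewrite cmapK.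
pose chi q := if `[< cdom c q >] then bump (c p) r%:num (c q) else 0.
have chiE q : cdom c q -> chi q = bump (c p) r%:num (c q).
  by move=> cq; rewrite /chi; case: asboolP.
have chi0 q : (~` K) q -> chi q = 0.
  move=> nK; rewrite /chi; case: asboolP => // cq; apply/eqP/negPn/negP => b0.
  by apply: nK; exists (c q); [exact: bump_supp b0|rewrite cmapK].
exists chi; split.
- by rewrite chiE // bump_gt0.
- move=> k; have oU := @chart_image_open _ _ _ c setT openT.
  apply: (Ck_ext oU _ (Ck_bump k (c p) r%:num oU)) => _ [q [cq _] <-].
  by rewrite /= cmapK // chiE.
move=> u; apply: chartwise_local => q0.
have [cq0|ncq0] := pselect (cdom c q0); last first.
  exists (~` K); first by move=> /Kdom.
  move=> c' ac' k; have oW : open (~` K) by rewrite openC.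
  apply: (Ck_ext (chart_image_open c' oW) _ (Ck_cst k _ 0)).
  move=> _ [q [cq nKq] <-]; rewrite /= cmapK // chi0 // scale0r.
  by rewrite coordsE // mul0mx.
exists (cdom c) => // c' ac' k.
have oU := chart_image_open c' (cdom_open c).
have oU' := chart_image_open c (cdom_open c').
have H2 := (atlas_compat ac ac' k.+1).2 u.
have Hh : Ck k (c @` (cdom c `&` cdom c'))
    (fun y => bump (c p) r%:num y *: 'D_u (trans c c') y).
  apply: Ck_row => // j.
  have := CkM oU' (Ck_bump k (c p) r%:num oU') (Ck_coord j oU' H2).
  by apply: Ck_ext => // y _; rewrite mxE.
have UU' x : (c' @` (cdom c' `&` cdom c)) x ->
    (c @` (cdom c `&` cdom c')) ((c \o cinv c') x).
  by move=> [q [c'q cq] <-]; rewrite /= cmapK //; exact: chart_mem.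
have := Ck_comp oU oU' UU' (atlas_compat ac' ac k) Hh.
apply: Ck_ext => // _ [q [c'q cq] <-]; rewrite /= cmapK // chiE //.
by rewrite [RHS](coordsE _ ac' c'q) -scalemxAl -(coordsE _ ac' c'q)
  (coords_tvec _ ac ac' cq c'q).
Qed.

(** Passes from equations between global fields to equations between tangent
vectors at a point. *)
Lemma exists_smooth_vec p (v : 'rV[R]_m) :
  exists2 Z : vecfield M, smooth_vec setT Z & Z p = v.
Proof.
have [chi [chi0 _ H]] := smooth_cutoff (chart_at_atlas p) (chart_at_dom p).
exists (fun q => chi q *: tvec (chart_at p) q ((chi p)^-1 *: v)); first exact: H.
by rewrite tvec_at scalerA divff ?scale1r // gt_eqF.
Qed.

(** The coordinate fields are not global, but their products with a cutoff function
are, and the cutoff function can be divided out where it does not vanish. *)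
Lemma smooth_cov_test (a : covfield M) :
  (forall Z, smooth_vec setT Z -> smooth_fun_on setT (fun q => ev (a q) (Z q))) ->
  smooth_cov setT a.
Proof.
move=> Ha u c ac k; apply: Ck_local => _ [p [cp _] <-].
have [chi [chi0 Hchi Hvec]] := smooth_cutoff ac cp.
have oU := @chart_image_open _ _ _ c setT openT.
set U := [set c x | x in _] in oU.
pose U' := U `&` [set x | chi (cinv c x) != 0]^°.
have oU' : open U' by apply: openI => //; exact: open_interior.
have sU : U' `<=` U by move=> x [].
have Up : U' (c p).
  split; first exact: chart_mem.
  have : {for c p, continuous (chi \o cinv c)}.
    by apply: (Hchi 0%N); exact: chart_mem.
  move=> cv; have : \forall y \near ((chi \o cinv c) (c p) : R^o), y != 0.
    rewrite /= cmapK //; apply: open_nbhs_nbhs; split; last by rewrite /= gt_eqF.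
    exact: open_neq.
  by move=> /cv.
have H1 : Ck k U' (fun x => ev (a (cinv c x)) (chi (cinv c x) *: tvec c (cinv c x) u) : R^o).
  exact: (Ck_sub sU (Ha _ (Hvec u) c ac k)).
have H2 : Ck k U' (fun x => (chi (cinv c x))^-1 : R^o).
  apply: CkV => //; last exact: Ck_sub (Hchi k).
  by move=> x [_ /interior_subset].
have := CkM oU' H1 H2.
move=> H; apply: (@Ck_sub _ _ _ k U') => [_ -> //|].
apply: Ck_ext H => // x [_ /interior_subset /= x0].
by rewrite !evE mulr_suml; apply: eq_bigr => j _; rewrite mxE mulrCA mulrAC mulfV // mul1r.
Qed.

End Cutoff.

(** * Bilinearity *)

Section BilAlgebra.
Context {R : realType} {m : nat}.
Implicit Types (b : 'M[R]_m) (u v w a : 'rV[R]_m).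

Lemma evDl a a' u : ev (a + a') u = ev a u + ev a' u.
Proof. by rewrite /ev mulmxDl mxE. Qed.
Lemma evNl a u : ev (- a) u = - ev a u.
Proof. by rewrite /ev mulNmx mxE. Qed.
Lemma evBl a a' u : ev (a - a') u = ev a u - ev a' u.
Proof. by rewrite evDl evNl. Qed.
Lemma evZl k a u : ev (k *: a) u = k * ev a u.
Proof. by rewrite /ev -scalemxAl mxE. Qed.
Lemma evDr a u u' : ev a (u + u') = ev a u + ev a u'.
Proof. by rewrite /ev linearD mulmxDr mxE. Qed.
Lemma evNr a u : ev a (- u) = - ev a u.
Proof. by rewrite /ev linearN mulmxN mxE. Qed.
Lemma evBr a u u' : ev a (u - u') = ev a u - ev a u'.
Proof. by rewrite evDr evNr. Qed.
Lemma evZr k a u : ev a (k *: u) = k * ev a u.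
Proof. by rewrite /ev linearZ -scalemxAr mxE. Qed.
Lemma ev0r a : ev a 0 = 0.
Proof. by rewrite /ev trmx0 mulmx0 mxE. Qed.

Lemma ev0l u : ev 0 u = 0.
Proof. by rewrite /ev mul0mx mxE. Qed.

Lemma ev_sumr (I : finType) a (k : I -> R) (f : I -> 'rV[R]_m) :
  ev a (\sum_i k i *: f i) = \sum_i k i * ev a (f i).
Proof.
rewrite (big_morph (ev a) (evDr a) (ev0r a)).
by apply: eq_bigr => i _; rewrite evZr.
Qed.

Lemma bilDl b u u' v : bil b (u + u') v = bil b u v + bil b u' v.
Proof. by rewrite !bilE mulmxDl evDl. Qed.
Lemma bilNl b u v : bil b (- u) v = - bil b u v.
Proof. by rewrite !bilE mulNmx evNl. Qed.
Lemma bilBl b u u' v : bil b (u - u') v = bil b u v - bil b u' v.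
Proof. by rewrite bilDl bilNl. Qed.
Lemma bilZl b k u v : bil b (k *: u) v = k * bil b u v.
Proof. by rewrite !bilE -scalemxAl evZl. Qed.
Lemma bilDr b u v v' : bil b u (v + v') = bil b u v + bil b u v'.
Proof. by rewrite !bilE evDr. Qed.
Lemma bilNr b u v : bil b u (- v) = - bil b u v.
Proof. by rewrite !bilE evNr. Qed.
Lemma bilBr b u v v' : bil b u (v - v') = bil b u v - bil b u v'.
Proof. by rewrite bilDr bilNr. Qed.
Lemma bilZr b k u v : bil b u (k *: v) = k * bil b u v.
Proof. by rewrite !bilE evZr. Qed.
Lemma bilDm b b' u v : bil (b + b') u v = bil b u v + bil b' u v.
Proof. by rewrite !bilE mulmxDr evDl. Qed.
Lemma bilZm b k u v : bil (k *: b) u v = k * bil b u v.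
Proof. by rewrite !bilE -scalemxAr evZl. Qed.

Lemma mx_linE k b b' (i j : 'I_m) : (k *: b + b') i j = k * b i j + b' i j.
Proof. by rewrite !mxE. Qed.

Lemma bil_tr b u v : bil b u v = bil b^T v u.
Proof.
rewrite /bil; have -> : u *m b *m v^T = (v *m b^T *m u^T)^T.
  by rewrite !trmx_mul !trmxK mulmxA.
by rewrite mxE.
Qed.

Lemma ev_flat b u v : ev (flat b u) v = bil b u v.
Proof. by []. Qed.

Lemma bil_sharp b a v : b \in unitmx -> bil b (sharp b a) v = ev a v.
Proof. by move=> ub; rewrite bilE /sharp mulmxKV. Qed.

End BilAlgebra.

(** * Invariant formulas for brackets, Lie and exterior derivatives *)

Section DirCalc.
Context {R : realType} {m : nat} {M : smoothManifold R m}.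
Implicit Types (p q : M) (X Y Z : vecfield M) (a : covfield M).
Implicit Types (f g : M -> R) (b psi : M -> 'M[R]_m) (u v w : 'rV[R]_m).

Lemma dir_lin (f : M -> R^o) p k u v :
  differentiable (f \o cinv (chart_at p)) (chart_at p p) ->
  dir (k *: u + v) f p = k * dir u f p + dir v f p.
Proof. by move=> df; rewrite /dir !(deriveE _ df) linearP. Qed.

Lemma dirD f g p u : smooth_fun f -> smooth_fun g ->
  dir u (fun q => f q + g q : R^o) p =
  dir u (f : M -> R^o) p + dir u (g : M -> R^o) p.
Proof.
move=> Hf Hg; apply: deriveD; apply: diff_derivable; exact: dir_differentiable.
Qed.

Lemma ev_dfun f p u : smooth_fun f ->
  ev (dfun f p) u = dir u (f : M -> R^o) p.
Proof.
move=> Hf; have df := dir_differentiable p Hf.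
rewrite evE /dir [RHS]derive_dir_sum //; apply: eq_bigr => i _.
by rewrite mxE mulrC.
Qed.

Lemma near_chart_at p :
  \forall x \near chart_at p p, exists2 q : M, cdom (chart_at p) q & chart_at p q = x.
Proof.
have := chart_near openT (chart_at_dom p) I.
by apply: filterS => _ [q [cq _] <-]; exists q.
Qed.

Lemma dir_near (V : normedModType R) (f g : M -> V) p u :
  (forall q, cdom (chart_at p) q -> f q = g q) -> dir u f p = dir u g p.
Proof.
move=> fg; apply: near_eq_derive; apply: filterS (near_chart_at p).
by move=> _ [q cq <-]; rewrite /= cmapK // fg.
Qed.

Lemma chartwise_differentiable (V : normedModType R)
    (f : chart R m M -> M -> V) p : chartwise_smooth setT f ->
  differentiable (f (chart_at p) \o cinv (chart_at p)) (chart_at p p).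
Proof.
move=> Hf; have [H _] := Hf _ (chart_at_atlas p) 1%N.
by apply: H; apply: chart_mem => //; exact: chart_at_dom.
Qed.

(** Derivatives of components in the preferred chart at p.  They depend on that
chart; the invariant formulas below are those combinations in which this
dependence cancels. *)
Definition dvec_comp w X p : 'rV[R]_m :=
  dir w (fun q => coords (chart_at p) q (X q)) p.

Lemma lie_bracketE X Y p : lie_bracket X Y p = dvec_comp (X p) Y p - dvec_comp (Y p) X p.
Proof. by []. Qed.

Lemma cov_comp_at a p : cov_comp a (chart_at p) p = a p.
Proof.
apply/rowP => i; rewrite -!ev_bvec -ev_tvec ?tvec_at //;
  by [exact: chart_at_atlas|exact: chart_at_dom].
Qed.

Lemma bil_form_comp_at b p u v : bil (form_comp b (chart_at p) p) u v = bil (b p) u v.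
Proof.
rewrite -bil_tvec ?tvec_at //; by [exact: chart_at_atlas|exact: chart_at_dom].
Qed.

Lemma dvec_compE w X p : smooth_vec setT X ->
  dvec_comp w X p = \row_j 'D_w (fun x => (coords (chart_at p) (cinv (chart_at p) x)
                               (X (cinv (chart_at p) x))) 0 j : R^o) (chart_at p p).
Proof.
move=> HX; apply: derive_row.
exact: (chartwise_differentiable (f := fun c q => coords c q (X q)) p HX).
Qed.

Definition dcov_comp w a p : 'rV[R]_m :=
  \row_j dir w (fun q => cov_comp a (chart_at p) q 0 j : R^o) p.

Lemma dir_ev_tvec a p w u : smooth_cov setT a ->
  dir w (fun q => ev (a q) (tvec (chart_at p) q u) : R^o) p = ev (dcov_comp w a p) u.
Proof.
move=> /(smooth_covP _ openT) Ha.
have da := differentiable_row (chartwise_differentiable p Ha).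
have ac := chart_at_atlas p.
have dc j : differentiable (fun y : 'rV[R]_m => u 0 j : R^o) (chart_at p p).
  exact: differentiable_cst.
have -> : dir w (fun q => ev (a q) (tvec (chart_at p) q u) : R^o) p =
    dir w (fun q => ev (cov_comp a (chart_at p) q) u : R^o) p.
  by apply: dir_near => q cq; rewrite -ev_tvec.
have z0 : \row_j 'D_w (fun=> u 0 j : R^o) (chart_at p p) = 0.
  by apply/rowP => j; rewrite !mxE; exact: derive_cst.
by rewrite [LHS](derive_ev (u := fun=> u) w da dc) z0 ev0r addr0.
Qed.

Lemma dir_ev a X p w : smooth_cov setT a -> smooth_vec setT X ->
  dir w (fun q => ev (a q) (X q) : R^o) p =
  dir w (fun q => ev (a q) (tvec (chart_at p) q (X p)) : R^o) p +
  ev (a p) (dvec_comp w X p).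
Proof.
move=> Ha0 HX; rewrite (dir_ev_tvec p w (X p) Ha0).
have /(smooth_covP _ openT) Ha := Ha0.
have da := differentiable_row (chartwise_differentiable p Ha).
have dX := differentiable_row (chartwise_differentiable p HX).
have ac := chart_at_atlas p; have cp := chart_at_dom p.
have -> : dir w (fun q => ev (a q) (X q) : R^o) p =
    dir w (fun q => ev (cov_comp a (chart_at p) q)
                       (coords (chart_at p) q (X q)) : R^o) p.
  by apply: dir_near => q cq; rewrite -ev_cov_comp.
pose p' := cinv (chart_at p) (chart_at p p).
transitivity (ev (dcov_comp w a p) (coords (chart_at p) p' (X p')) +
    ev (cov_comp a (chart_at p) p') (dvec_comp w X p)).
  by rewrite (dvec_compE w p HX); exact: (derive_ev w da dX).
by rewrite /p' cmapK // coords_at cov_comp_at.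
Qed.

Definition dform_comp b w p : 'M[R]_m :=
  \matrix_(i, j) dir w (fun q => form_comp b (chart_at p) q i j : R^o) p.

Lemma dform_comp_differentiable b p i j : smooth_bil b ->
  differentiable (fun x => form_comp b (chart_at p) (cinv (chart_at p) x) i j : R^o)
    (chart_at p p).
Proof.
move=> Hb; exact: (chartwise_differentiable (V := R^o) p (smooth_form_comp openT Hb i j)).
Qed.

Lemma dir_bil b X Y p w : smooth_bil b -> smooth_vec setT X -> smooth_vec setT Y ->
  dir w (fun q => bil (b q) (X q) (Y q) : R^o) p =
  bil (dform_comp b w p) (X p) (Y p) +
  bil (b p) (dvec_comp w X p) (Y p) + bil (b p) (X p) (dvec_comp w Y p).
Proof.
move=> Hb HX HY.
have dX := differentiable_row (chartwise_differentiable p HX).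
have dY := differentiable_row (chartwise_differentiable p HY).
have dB i j := dform_comp_differentiable p i j Hb.
have ac := chart_at_atlas p; have cp := chart_at_dom p.
have -> : dir w (fun q => bil (b q) (X q) (Y q) : R^o) p =
    dir w (fun q => bil (form_comp b (chart_at p) q)
    (coords (chart_at p) q (X q)) (coords (chart_at p) q (Y q)) : R^o) p.
  by apply: dir_near => q cq; rewrite -bil_form_comp.
pose p' := cinv (chart_at p) (chart_at p p).
transitivity (bil (dform_comp b w p) (coords (chart_at p) p' (X p'))
      (coords (chart_at p) p' (Y p')) +
    bil (form_comp b (chart_at p) p') (dvec_comp w X p) (coords (chart_at p) p' (Y p')) +
    bil (form_comp b (chart_at p) p') (coords (chart_at p) p' (X p')) (dvec_comp w Y p)).
  rewrite (dvec_compE w p HX) (dvec_compE w p HY); exact: (derive_bil w dB dX dY).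
by rewrite /p' cmapK // !coords_at !bil_form_comp_at.
Qed.

Lemma dir_bil_tvec b p w u v : smooth_bil b ->
  dir w (fun q => bil (b q) (tvec (chart_at p) q u) (tvec (chart_at p) q v) : R^o) p =
  bil (dform_comp b w p) u v.
Proof.
move=> Hb; have dB i j := dform_comp_differentiable p i j Hb.
have dc (z : 'rV[R]_m) j : differentiable (fun y : 'rV[R]_m => z 0 j : R^o) (chart_at p p).
  exact: differentiable_cst.
have ac := chart_at_atlas p.
have -> : dir w (fun q => bil (b q) (tvec (chart_at p) q u)
      (tvec (chart_at p) q v) : R^o) p =
    dir w (fun q => bil (form_comp b (chart_at p) q) u v : R^o) p.
  by apply: dir_near => q cq; rewrite -bil_tvec.
have z0 (z : 'rV[R]_m) : \row_j 'D_w (fun=> z 0 j : R^o) (chart_at p p) = 0.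
  by apply/rowP => j; rewrite !mxE; exact: derive_cst.
transitivity (bil (dform_comp b w p) u v +
    bil (form_comp b (chart_at p) (cinv (chart_at p) (chart_at p p))) 0 v +
    bil (form_comp b (chart_at p) (cinv (chart_at p) (chart_at p p))) u 0).
  rewrite -{1}(z0 u) -{1}(z0 v).
  exact: (derive_bil (u := fun=> u) (v := fun=> v) w dB (dc u) (dc v)).
by rewrite !bilE mul0mx ev0r ev0l !addr0.
Qed.

Lemma d2formE psi p u v w : smooth_bil psi ->
  d2form psi p u v w = bil (dform_comp psi u p) v w - bil (dform_comp psi v p) u w
                       + bil (dform_comp psi w p) u v.
Proof. by move=> Hpsi; rewrite /d2form !dir_bil_tvec. Qed.

Lemma dform_compE b w p i j :
  dform_comp b w p i j = dir w (fun q => form_comp b (chart_at p) q i j : R^o) p.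
Proof. exact: mxE. Qed.

Lemma dform_comp_linear b p k u v : smooth_bil b ->
  dform_comp b (k *: u + v) p = k *: dform_comp b u p + dform_comp b v p.
Proof.
move=> Hb; apply/matrixP => i j; rewrite mx_linE.
have L := dir_lin (f := fun q => form_comp b (chart_at p) q i j : R^o) k u v
  (dform_comp_differentiable p i j Hb).
exact: (etrans (dform_compE _ _ _ _ _) (etrans L (f_equal2 +%R (f_equal ( *%R k)
  (esym (dform_compE _ _ _ _ _))) (esym (dform_compE _ _ _ _ _))))).
Qed.

Lemma form_comp_tr psi c : (forall q, (psi q)^T = - psi q) ->
  forall q, (form_comp psi c q)^T = - form_comp psi c q.
Proof.
by move=> tr q; rewrite /form_comp !trmx_mul trmxK tr mulNmx mulmxN mulmxA.
Qed.

Lemma dform_comp_antisym psi p w u v : two_form psi ->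
  bil (dform_comp psi w p) u v = - bil (dform_comp psi w p) v u.
Proof.
move=> [Hpsi alt].
have trpsi q : (psi q)^T = - psi q.
  by apply/matrixP => i j; rewrite !mxE -!bil_bvec alt.
have trd : (dform_comp psi w p)^T = - dform_comp psi w p.
  apply/matrixP => i j.
  transitivity (- dform_comp psi w p i j); last by rewrite [RHS]mxE.
  transitivity (dform_comp psi w p j i); first by rewrite [LHS]mxE.
  have dij := @diff_derivable _ _ _ _ _ w (dform_comp_differentiable p i j Hpsi).
  apply: (etrans (dform_compE _ _ _ _ _)).
  apply: (etrans _ (f_equal -%R (esym (dform_compE _ _ _ _ _)))).
  apply: etrans (deriveN dij).
  apply: (f_equal (fun f : _ -> R^o => 'D_w f (chart_at p p))).
  apply/funext => x; set q := cinv (chart_at p) x.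
  transitivity ((form_comp psi (chart_at p) q)^T i j); first by rewrite [RHS]mxE.
  rewrite form_comp_tr //; exact: mxE.
by rewrite bil_tr trd -scaleN1r bilZm mulN1r.
Qed.

(** By the product rule, the terms with derivatives of the fields on the right are
exactly those of the three brackets, up to the antisymmetry of psi. *)
Lemma cartan_formula psi X Y Z p : two_form psi ->
  smooth_vec setT X -> smooth_vec setT Y -> smooth_vec setT Z ->
  d2form psi p (X p) (Y p) (Z p) =
  dir (X p) (fun q => bil (psi q) (Y q) (Z q) : R^o) p
  - dir (Y p) (fun q => bil (psi q) (X q) (Z q) : R^o) p
  + dir (Z p) (fun q => bil (psi q) (X q) (Y q) : R^o) p
  - bil (psi p) (lie_bracket X Y p) (Z p)
  + bil (psi p) (lie_bracket X Z p) (Y p)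
  - bil (psi p) (lie_bracket Y Z p) (X p).
Proof.
move=> [Hpsi alt] HX HY HZ; rewrite d2formE // !dir_bil // !lie_bracketE.
move: (dvec_comp (X p) Y p) (dvec_comp (X p) Z p) (dvec_comp (Y p) X p) (dvec_comp (Y p) Z p).
move: (dvec_comp (Z p) X p) (dvec_comp (Z p) Y p) => ZX ZY XY XZ YX YZ.
move: (dform_comp psi (X p) p) (dform_comp psi (Y p) p) (dform_comp psi (Z p) p) => A B C.
rewrite !bilBl (alt p (Y p)) (alt p (X p) YZ) (alt p (X p) ZY).
by ring.
Qed.

Lemma dvec_comp_sum w X p : smooth_vec setT X ->
  dvec_comp w X p = \sum_j w 0 j *: dvec_comp (bvec j) X p.
Proof.
move=> HX; have dX := chartwise_differentiable p HX.
exact: (derive_dir_sum _ dX).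
Qed.

(** The Leibniz rule for the Lie derivative, read off at the point p. *)
Lemma ev_lie_derivative X (mu : covfield M) S p :
  smooth_vec setT X -> smooth_cov setT mu -> smooth_vec setT S ->
  ev (lie_derivative X mu p) (S p) =
  dir (X p) (fun q => ev (mu q) (S q) : R^o) p - ev (mu p) (lie_bracket X S p).
Proof.
move=> HX Hmu HS; rewrite dir_ev // lie_bracketE evBr.
rewrite dir_ev_tvec //.
have alg (r1 r2 r3 : R) : r1 + r2 - (r2 - r3) = r1 + r3 by ring.
rewrite alg.
rewrite (_ : lie_derivative X mu p = dcov_comp (X p) mu p +
  \row_i ev (mu p) (dvec_comp (bvec i) X p)); last first.
  apply/rowP => i; rewrite !mxE; congr (_ + _).
  by rewrite dir_ev_tvec // ev_bvec mxE.
rewrite evDl; congr (_ + _); rewrite evE.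
rewrite (dvec_comp_sum _ _ HX) ev_sumr; apply: eq_bigr => j _.
by rewrite mxE mulrC.
Qed.

End DirCalc.

(** * The fibres of E as graphs of isometries *)

Section Fiber.
Context {R : realType} {m : nat} {M : smoothManifold R m}.
Variables (G : gen_metric M) (gam psi : M -> 'M[R]_m).
Variables (E : M -> {vspace 'rV[R]_m * 'rV[R]_m}).
Variables (Psi : M -> 'End(('rV[R]_m * 'rV[R]_m)%type)) (F : M -> 'M[R]_m).
Hypotheses (gam_metric : riemannian_metric gam) (psi_form : two_form psi).
Hypotheses (GE : corresponds G gam psi) (E_dirac : almost_dirac E).
Hypotheses (PsiE : is_Psi G E Psi) (FE : is_F gam psi Psi F).
Implicit Types (p q : M) (u v x y : 'rV[R]_m) (s t : 'rV[R]_m * 'rV[R]_m).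

Local Notation lplus := (graph_lift gam psi 1).
Local Notation lminus := (graph_lift gam psi (-1)).

Lemma gam_unit p : gam p \in unitmx.
Proof.
have [_ _ pos] := gam_metric.
rewrite unitmxE unitfE; apply/negP => /det0P[v v0 vg].
by have := pos p v v0; rewrite bilE vg /ev mul0mx mxE ltxx.
Qed.

Lemma gam_sym p u v : bil (gam p) u v = bil (gam p) v u.
Proof. by have [_ H _] := gam_metric. Qed.

Lemma gam_eq0 p u : bil (gam p) u u = 0 -> u = 0.
Proof.
have [_ _ pos] := gam_metric; move=> u0; apply/eqP/negPn/negP => /(pos p).
by rewrite u0 ltxx.
Qed.

Lemma gam_inj p u v : (forall w, bil (gam p) u w = bil (gam p) v w) -> u = v.
Proof.
move=> H; apply/eqP; rewrite -subr_eq0; apply/eqP/(@gam_eq0 p).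
by rewrite bilBl H subrr.
Qed.

Lemma psi_alt p u v : bil (psi p) u v = - bil (psi p) v u.
Proof. by have [_ H] := psi_form. Qed.

(** The V+ and V- components of s, as tangent vectors: for s = l+ x + l- y one has
s.1 = x + y and s.2 = psi (x + y) + gam (x - y). *)
Definition plus_part p s : 'rV[R]_m :=
  2^-1 *: (s.1 + sharp (gam p) (s.2 - flat (psi p) s.1)).
Definition minus_part p s : 'rV[R]_m :=
  2^-1 *: (s.1 - sharp (gam p) (s.2 - flat (psi p) s.1)).

Lemma plus_part_linear p : linear (plus_part p).
Proof.
move=> k s t; have sl (a b : 'rV[R]_m) : sharp (gam p) (k *: a + b) =
    k *: sharp (gam p) a + sharp (gam p) b.
  by rewrite /sharp mulmxDl -scalemxAl.
have -> : plus_part p (k *: s + t) = 2^-1 *: (k *: s.1 + t.1 +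
    sharp (gam p) (k *: (s.2 - flat (psi p) s.1) + (t.2 - flat (psi p) t.1))).
  rewrite /plus_part /flat /=; congr (_ *: (_ + sharp _ _)).
  rewrite mulmxDl -scalemxAl scalerBr opprD !addrA; congr (_ - _).
  by rewrite addrAC.
rewrite sl /plus_part; move: (sharp _ _) (sharp _ _) => a b.
by apply/rowP => j; rewrite !mxE; ring.
Qed.

Lemma lift_split p s : s = lplus p (plus_part p s) + lminus p (minus_part p s).
Proof.
have half (w : 'rV[R]_m) : 2^-1 *: w + 2^-1 *: w = w.
  by rewrite -scalerDl -[2^-1]div1r -splitr scale1r.
case: s => s1 s2; rewrite /graph_lift /plus_part /minus_part /=; congr (_, _) => /=.
  by rewrite -scalerDr addrACA subrr addr0 scalerDr half.
have zg : s2 - flat (psi p) s1 = sharp (gam p) (s2 - flat (psi p) s1) *m gam p.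
  by rewrite /sharp mulmxKV // gam_unit.
move: (sharp _ _) zg => z /(canRL (subrK _)) ->.
rewrite /flat !mulmxDr scale1r scaleN1r mulmxN -!scalemxAl !(mulmxDl, mulNmx).
move: (z *m _) (z *m _) (s1 *m _) (s1 *m _) => a b c d.
by apply/rowP => j; rewrite !mxE; field.
Qed.

Lemma neutral_lift p e e' u v :
  neutral (graph_lift gam psi e p u) (graph_lift gam psi e' p v) =
  (e + e') * bil (gam p) u v.
Proof.
rewrite /neutral /= !ev_flat !bilDm !bilZm (psi_alt p u v) (gam_sym p v u).
by ring.
Qed.

Lemma neutralDl s s' t : neutral (s + s') t = neutral s t + neutral s' t.
Proof. by rewrite /neutral /= evDl evDr; ring. Qed.

Lemma neutralC s t : neutral s t = neutral t s.
Proof. by rewrite /neutral addrC. Qed.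

Lemma neutral_split p x y x' y' :
  neutral (lplus p x + lminus p y) (lplus p x' + lminus p y') =
  2 * (bil (gam p) x x' - bil (gam p) y y').
Proof.
rewrite neutralDl ![neutral _ (_ + _)]neutralC !neutralDl !neutral_lift.
rewrite (gam_sym p x' x) (gam_sym p y' y); ring.
Qed.

Lemma dirac_isometry_parts p s t : s \in E p -> t \in E p ->
  bil (gam p) (plus_part p s) (plus_part p t) = bil (gam p) (minus_part p s) (minus_part p t).
Proof.
move=> sE tE; have [_ /(_ p s t sE tE)] := E_dirac.
rewrite {1}(lift_split p s) {1}(lift_split p t) neutral_split => /eqP.
by rewrite mulf_eq0 pnatr_eq0 /= subr_eq0 => /eqP.
Qed.

Lemma dim_dirac p : \dim (E p) = m.
Proof.
have [/(_ p)[W [s [_ Wp _ /(_ p Wp) bs]]] _] := E_dirac.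
by case/andP: bs => /eqP <- /eqP ->; rewrite size_image card_ord.
Qed.

(** An element of E without V+ component has a V- component of length zero, by
isotropy; so the projection of E to V+ is injective, and both have rank m. *)
Lemma plus_part_surj p u : exists2 s, s \in E p & plus_part p s = u.
Proof.
pose L0 := GRing.isLinear.Build _ _ _ _ _ (plus_part_linear p).
pose L : {linear ('rV[R]_m * 'rV[R]_m)%type -> 'rV[R]_m} := HB.pack (plus_part p) L0.
have ker0 : (E p :&: lker (linfun L))%VS = 0%VS.
  apply/eqP; rewrite -subv0; apply/subvP => s; rewrite memv_cap memv_ker lfunE /=.
  move=> /andP[sE /eqP x0]; rewrite memv0.
  have := dirac_isometry_parts sE sE; rewrite x0 {1}bilE mul0mx /ev mul0mx mxE.
  move=> /esym /gam_eq0 y0.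
  by rewrite (lift_split p s) x0 y0 /graph_lift /flat !mul0mx addr0.
have full : (linfun L @: E p)%VS = fullv.
  apply/eqP; rewrite eqEdim subvf /= limg_dim_eq // dim_dirac dimvf /dim /=.
  by rewrite mul1n.
have : u \in (linfun L @: E p)%VS by rewrite full memvf.
by move=> /memv_imgP[s sE ->]; exists s => //; rewrite lfunE.
Qed.

Lemma gform_split p x y x' y' :
  G p (lplus p x + lminus p y) (lplus p x' + lminus p y') =
  2 * (bil (gam p) x x' + bil (gam p) y y').
Proof.
have addl s s' t : G p (s + s') t = G p s t + G p s' t.
  by have := gform_linear G p 1 s s' t; rewrite scale1r mul1r.
have pl z : lplus p z \in gplus G p by apply/(GE p _).1; exists z.
have mi z : lminus p z \in gminus G p by apply/(GE p _).2; exists z.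
rewrite addl ![G p _ (_ + _)]gform_sym !addl.
rewrite !(gform_plus (pl _) (pl _)) !(gform_minus (mi _) (mi _)).
rewrite (gform_sym G p (lminus p y') (lplus p x)).
rewrite (gperp (pl x) (mi y')).2 (gperp (pl x') (mi y)).2.
rewrite !neutral_lift (gam_sym p x' x) (gam_sym p y' y); ring.
Qed.

(** For s = l+ x + l- y in E, the vector s' = l+ x - l- y is G-orthogonal to E, again
by isotropy.  Hence Psi s = s and Psi s' = - s', so that Psi (l+ x) = l- y, which
says y = F x. *)
Lemma minus_partE p s : s \in E p -> minus_part p s = plus_part p s *m F p.
Proof.
move=> sE; set x := plus_part p s; set y := minus_part p s.
have sxy : s = lplus p x + lminus p y := lift_split p s.
pose s' := lplus p x - lminus p y.
have s'E : s' = lplus p x + lminus p (- y).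
  by rewrite /s' /graph_lift /flat mulNmx.
have [E1 E2] := PsiE p.
have Ps : Psi p s = s.
  have : s \in passmx.leigenspace (Psi p) 1 by rewrite E1.
  by rewrite /passmx.leigenspace memv_ker add_lfunE opp_lfunE scale_lfunE id_lfunE subr_eq0 => /eqP;
    rewrite scale1r.
have Ps' : Psi p s' = - s'.
  have : s' \in passmx.leigenspace (Psi p) (-1).
    apply/E2 => t tE; rewrite s'E (lift_split p t) gform_split bilNl.
    by rewrite dirac_isometry_parts // subrr mulr0.
  by rewrite /passmx.leigenspace memv_ker add_lfunE opp_lfunE scale_lfunE id_lfunE subr_eq0 => /eqP;
    rewrite scaleN1r.
have e1 : s + s' = 2 *: lplus p x by rewrite sxy addrACA subrr addr0 scaler_nat mulr2n.
have e2 : s - s' = 2 *: lminus p y.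
  by rewrite sxy opprB addrC addrA subrK -mulr2n scaler_nat.
have : 2 *: Psi p (lplus p x) = 2 *: lminus p y.
  have -> : 2 *: Psi p (lplus p x) = Psi p (s + s') by rewrite e1 linearZ.
  have -> : Psi p (s + s') = Psi p s + Psi p s' by exact: linearD.
  by rewrite Ps Ps' e2.
have two0 : (2 : R) != 0 by rewrite pnatr_eq0.
by move=> /(scalerI two0); rewrite FE => -[->].
Qed.

Definition dirac_lift p u := lplus p u + lminus p (u *m F p).

Lemma dirac_fiberP p s : reflect (exists u, s = dirac_lift p u) (s \in E p).
Proof.
apply: (iffP idP) => [sE|[u ->]].
  by exists (plus_part p s); rewrite /dirac_lift -minus_partE // -lift_split.
have [s' s'E <-] := plus_part_surj p u.
by rewrite /dirac_lift -minus_partE // -lift_split.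
Qed.

Lemma F_isometry p u v :
  bil (gam p) (u *m F p) (v *m F p) = bil (gam p) u v.
Proof.
have [s sE <-] := plus_part_surj p u; have [t tE <-] := plus_part_surj p v.
by rewrite -!minus_partE // dirac_isometry_parts.
Qed.

Lemma F_inj p u : u *m F p = 0 -> u = 0.
Proof.
move=> uF0; apply: (@gam_eq0 p); rewrite -F_isometry uF0.
by rewrite bilE mul0mx ev0l.
Qed.

Lemma F_unit p : F p \in unitmx.
Proof.
rewrite unitmxE unitfE; apply/negP => /det0P[v v0 vF].
by move: v0; rewrite (F_inj vF) eqxx.
Qed.

(** If s = l+ x + l- y pairs to zero with E, then gam(x, u) = gam(y, F u) for all u,
and F is an isometry. *)
Lemma dirac_maximal p s : (forall u, neutral s (dirac_lift p u) = 0) -> s \in E p.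
Proof.
move=> H; apply/dirac_fiberP; exists (plus_part p s).
rewrite {1}(lift_split p s) /dirac_lift; congr (_ + lminus p _).
apply: (@gam_inj p) => w; rewrite -[w](mulmxKV (F_unit p)) F_isometry.
have := H (w *m invmx (F p)); rewrite {1}(lift_split p s) neutral_split.
by move=> /eqP; rewrite mulf_eq0 pnatr_eq0 /= subr_eq0 => /eqP.
Qed.

Lemma plus_part_lift p x y : plus_part p (lplus p x + lminus p y) = x.
Proof.
have e : lplus p x + lminus p y =
    lplus p (plus_part p (lplus p x + lminus p y)) +
    lminus p (minus_part p (lplus p x + lminus p y)) := lift_split _ _.
set x' := plus_part _ _ in e *; set y' := minus_part _ _ in e.
apply: (@gam_inj p) => w.
have := f_equal (fun s => neutral s (lplus p w + lminus p 0)) e.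
rewrite !neutral_split !(bilE _ _ 0) !ev0r !subr0.
by move=> /(mulfI _) ->; rewrite ?pnatr_eq0.
Qed.

Lemma minus_part_lift p x y : minus_part p (lplus p x + lminus p y) = y.
Proof.
have e : lplus p x + lminus p y =
    lplus p (plus_part p (lplus p x + lminus p y)) +
    lminus p (minus_part p (lplus p x + lminus p y)) := lift_split _ _.
rewrite plus_part_lift in e; move/addrI: e => [e _]; by rewrite -e.
Qed.

Lemma lift_dirac p x y : lplus p x + lminus p y \in E p <-> y = x *m F p.
Proof.
split=> [sE|->]; last by apply/dirac_fiberP; exists x.
by have := minus_partE sE; rewrite plus_part_lift minus_part_lift.
Qed.

End Fiber.

(** * Smoothness of F and the global sections of E *)

Section SmoothF.
Context {R : realType} {m : nat} {M : smoothManifold R m}.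
Variables (G : gen_metric M) (gam psi : M -> 'M[R]_m).
Variables (E : M -> {vspace 'rV[R]_m * 'rV[R]_m}).
Variables (Psi : M -> 'End(('rV[R]_m * 'rV[R]_m)%type)) (F : M -> 'M[R]_m).
Hypotheses (gam_metric : riemannian_metric gam) (psi_form : two_form psi).
Hypotheses (GE : corresponds G gam psi) (E_dirac : almost_dirac E).
Hypotheses (PsiE : is_Psi G E Psi) (FE : is_F gam psi Psi F).
Implicit Types (W : set M) (X Y : vecfield M) (s t : bigfield M).

Let gam_smooth : smooth_bil gam. Proof. by have [] := gam_metric. Qed.
Let psi_smooth : smooth_bil psi. Proof. by have [] := psi_form. Qed.

Lemma smooth_bil_comb (b b' : M -> 'M[R]_m) (r : R) :
  smooth_bil b -> smooth_bil b' -> smooth_bil (fun q => b q + r *: b' q).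
Proof.
move=> Hb Hb' u v c ac k; have oU := chart_image_open c (@openT M).
have := CkD oU (Hb u v c ac k) (CkM oU (Ck_cst k _ (r : R^o)) (Hb' u v c ac k)).
by apply: Ck_ext => // x _ /=; rewrite bilDm bilZm.
Qed.

Lemma smooth_lift W (r : R) X : open W -> smooth_vec W X ->
  smooth_big W (fun q => graph_lift gam psi r q (X q)).
Proof.
move=> oW HX; split => //=.
by apply: smooth_flat => //; exact: smooth_bil_comb.
Qed.

Lemma smooth_bigD W s t : open W -> smooth_big W s -> smooth_big W t ->
  smooth_big W (fun q => s q + t q).
Proof.
move=> oW [H1 H2] [H1' H2'].
by split; [exact: (smooth_vecD oW H1 H1')|exact: (smooth_covD oW H2 H2')].
Qed.

Lemma smooth_sharp_part W s : open W -> smooth_big W s ->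
  smooth_vec W (fun q => sharp (gam q) ((s q).2 - flat (psi q) (s q).1)).
Proof.
move=> oW [H1 H2]; apply: smooth_sharp => //; first exact: gam_unit.
by apply: smooth_covD => //; apply: smooth_covN => //; exact: smooth_flat.
Qed.

Lemma smooth_plus_part W s : open W -> smooth_big W s ->
  smooth_vec W (fun q => plus_part gam psi q (s q)).
Proof.
move=> oW Hs; apply: smooth_vecZ => //; first exact: smooth_fun_cst.
by apply: smooth_vecD => //; [case: Hs|exact: smooth_sharp_part].
Qed.

Lemma smooth_minus_part W s : open W -> smooth_big W s ->
  smooth_vec W (fun q => minus_part gam psi q (s q)).
Proof.
move=> oW Hs; apply: smooth_vecZ => //; first exact: smooth_fun_cst.
by apply: smooth_vecB => //; [case: Hs|exact: smooth_sharp_part].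
Qed.

(** A frame of E projects to a frame of the tangent space, since F determines the
other component. *)
Lemma plus_parts_unit q (s : 'I_m -> 'rV[R]_m * 'rV[R]_m) :
  basis_of (E q) [seq s i | i : 'I_m] ->
  \matrix_i plus_part gam psi q (s i) \in unitmx.
Proof.
move=> bs; have bt : basis_of (E q) [tuple s i | i < m] by exact: bs.
have sE i : s i \in E q.
  by apply: (basis_mem bs); apply: map_f; rewrite mem_enum.
rewrite unitmxE unitfE; apply/negP => /det0P[v v0 vN].
pose z := \sum_i v 0 i *: s i.
have zE : z \in E q by apply: memv_suml => i _; exact: memvZ.
have xz : plus_part gam psi q z = 0.
  pose L0 := GRing.isLinear.Build _ _ _ _ _ (plus_part_linear gam psi q).
  pose L : {linear ('rV[R]_m * 'rV[R]_m)%type -> 'rV[R]_m} :=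
    HB.pack (plus_part gam psi q) L0.
  rewrite -[LHS]/(L z) linear_sum -[RHS]vN mulmx_sum_row.
  by apply: eq_bigr => i _; rewrite linearZ /= rowK.
have z0 : z = 0.
  rewrite (lift_split psi gam_metric q z).
  rewrite (minus_partE gam_metric psi_form GE E_dirac PsiE FE zE).
  by rewrite xz /graph_lift /flat !mul0mx addr0.
have /freeP fr := basis_free bt.
apply/negP: v0; rewrite negbK; apply/eqP/rowP => i; rewrite mxE.
apply: (fr (fun i => v 0 i)); rewrite -[RHS]z0; apply: eq_bigr => j _.
by rewrite -tnth_nth tnth_mktuple.
Qed.

(** The V+ and V- components x_i, y_i of a local frame of E are smooth and satisfy
y_i = F x_i.  Expanding X in the frame (x_i) has smooth coefficients by Cramer's
rule, and F X has the same coefficients on the y_i. *)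
Lemma smooth_F X : smooth_vec setT X -> smooth_vec setT (endo_app F X).
Proof.
move=> HX; apply: chartwise_local => p.
have [/(_ p)[W [s [oW Wp Hs bs]]] _] := E_dirac.
exists W; first exact: Wp.
(* N is the frame (x_i); Xm and Ym hold the chart components of x_i and y_i. *)
pose N q : 'M[R]_m := \matrix_i plus_part gam psi q (s i q).
have uN q : W q -> N q \in unitmx by move=> Wq; exact: plus_parts_unit (bs q Wq).
pose Xm c q : 'M[R]_m := \matrix_i coords c q (plus_part gam psi q (s i q)).
pose Ym c q : 'M[R]_m := \matrix_i coords c q (minus_part gam psi q (s i q)).
have XmE c q : atlas c -> cdom c q -> Xm c q = N q *m coords_mx c q.
  by move=> ac cq; apply/row_matrixP => i; rewrite row_mul !rowK -coordsE.
have uX c q : atlas c -> cdom c q -> W q -> Xm c q \in unitmx.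
  move=> ac cq Wq; rewrite XmE // unitmx_mul uN //=.
  by have [_ ->] := mulmx1_unit (tvec_mx_coords_mx ac cq).
have YmE c q : atlas c -> cdom c q -> W q -> Ym c q = N q *m F q *m coords_mx c q.
  move=> ac cq Wq; apply/row_matrixP => i; rewrite !row_mul !rowK -(coordsE _ ac cq).
  apply: (f_equal (coords c q)); apply: (minus_partE gam_metric psi_form GE E_dirac PsiE FE).
  by apply: (basis_mem (bs q Wq)); apply: map_f; rewrite mem_enum.
have H : chartwise_smooth W (fun c q =>
    coords c q (X q) *m invmx (Xm c q) *m Ym c q).
  move=> c ac k; have oU := chart_image_open c oW.
  have HXm i j : Ck k (c @` (cdom c `&` W)) (fun x => Xm c (cinv c x) i j : R^o).
    have := Ck_coord j oU (smooth_plus_part oW (Hs i) ac k).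
    by apply: Ck_ext => // x _; rewrite [RHS]mxE.
  have HYm i j : Ck k (c @` (cdom c `&` W)) (fun x => Ym c (cinv c x) i j : R^o).
    have := Ck_coord j oU (smooth_minus_part oW (Hs i) ac k).
    by apply: Ck_ext => // x _; rewrite [RHS]mxE.
  have HXc := chartwise_sub (@subsetT _ W) HX ac k.
  apply: (Ck_mulmx (A := fun x => Ym c (cinv c x)) oU _ HYm).
  apply: (Ck_mulmx (A := fun x => invmx (Xm c (cinv c x))) oU HXc).
  apply: Ck_invmx => // _ [q [cq Wq] <-]; rewrite cmapK //; exact: uX.
apply: chartwise_ext H => // c q ac cq Wq.
have uC : coords_mx c q \in unitmx by have [_ ->] := mulmx1_unit (tvec_mx_coords_mx ac cq).
have e : coords c q (X q) *m invmx (Xm c q) *m N q = X q.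
  apply: (can_inj (mulmxK uC)).
  rewrite -[LHS](mulmxA _ (N q)) -(XmE c q ac cq).
  by rewrite (mulmxKV (uX c q ac cq Wq)) (coordsE _ ac cq).
rewrite (YmE c q ac cq Wq) /endo_app (coordsE (X q *m F q) ac cq).
by rewrite !mulmxA e.
Qed.

Definition dirac_section X : bigfield M := fun q => dirac_lift gam psi F q (X q).

Lemma dirac_section_global X : smooth_vec setT X ->
  global_section E (dirac_section X).
Proof.
move=> HX; split.
  apply: smooth_bigD; [exact: openT|exact: smooth_lift openT HX|].
  exact: smooth_lift openT (smooth_F HX).
move=> p; apply/(dirac_fiberP gam_metric psi_form GE E_dirac PsiE FE).
by exists (X p).
Qed.

Lemma global_section_dirac s : global_section E s ->
  exists2 X, smooth_vec setT X & s = dirac_section X.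
Proof.
move=> [Hs sE]; exists (fun q => plus_part gam psi q (s q)).
  exact: smooth_plus_part openT Hs.
apply/funext => q; rewrite /dirac_section /dirac_lift.
by rewrite -(minus_partE gam_metric psi_form GE E_dirac PsiE FE (sE q)) -lift_split.
Qed.

End SmoothF.

(** * The exterior derivative of psi as an alternating form *)

Section ThreeForm.
Context {R : realType} {m : nat} {M : smoothManifold R m}.
Variables (psi : M -> 'M[R]_m).
Hypothesis psi_form : two_form psi.
Implicit Types (p : M) (u v w : 'rV[R]_m).

Let psi_smooth : smooth_bil psi. Proof. by have [] := psi_form. Qed.

Lemma d2form_swap12 p u v w : d2form psi p u v w = - d2form psi p v u w.
Proof.
have H := dform_comp_antisym p w u v psi_form; rewrite !(d2formE _ _ _ _ psi_smooth).
move: (dform_comp psi u p) (dform_comp psi v p) (dform_comp psi w p) H => a b c ->; ring.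
Qed.

Lemma d2form_swap23 p u v w : d2form psi p u v w = - d2form psi p u w v.
Proof.
have H := dform_comp_antisym p u v w psi_form; rewrite !(d2formE _ _ _ _ psi_smooth).
move: (dform_comp psi u p) (dform_comp psi v p) (dform_comp psi w p) H => a b c ->; ring.
Qed.

Lemma d2form_linear1 p k u u' v w :
  d2form psi p (k *: u + u') v w = k * d2form psi p u v w + d2form psi p u' v w.
Proof.
rewrite !(d2formE _ _ _ _ psi_smooth) (dform_comp_linear p k u u' psi_smooth).
move: (dform_comp psi u p) (dform_comp psi u' p) (dform_comp psi v p) (dform_comp psi w p) => a b c d.
by rewrite !(bilDm, bilZm, bilDl, bilZl, bilDr, bilZr); ring.
Qed.

Lemma d2form_linear2 p k u v v' w :
  d2form psi p u (k *: v + v') w = k * d2form psi p u v w + d2form psi p u v' w.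
Proof.
move: (d2form psi p) (d2form_swap12 p) (d2form_linear1 p) => T S L.
by rewrite S L (S u v) (S u v'); ring.
Qed.

Lemma d2form_linear3 p k u v w w' :
  d2form psi p u v (k *: w + w') = k * d2form psi p u v w + d2form psi p u v w'.
Proof.
move: (d2form psi p) (d2form_swap23 p) (d2form_linear2 p) => T S L.
by rewrite S L (S u v w) (S u v w'); ring.
Qed.

Lemma d2formD1 p u u' v w :
  d2form psi p (u + u') v w = d2form psi p u v w + d2form psi p u' v w.
Proof.
move: (d2form psi p) (d2form_linear1 p) => T L.
by rewrite -[u in LHS]scale1r L mul1r.
Qed.

Lemma d2formD2 p u v v' w :
  d2form psi p u (v + v') w = d2form psi p u v w + d2form psi p u v' w.
Proof.
move: (d2form psi p) (d2form_linear2 p) => T L.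
by rewrite -[v in LHS]scale1r L mul1r.
Qed.

Lemma d2formD3 p u v w w' :
  d2form psi p u v (w + w') = d2form psi p u v w + d2form psi p u v w'.
Proof.
move: (d2form psi p) (d2form_linear3 p) => T L.
by rewrite -[w in LHS]scale1r L mul1r.
Qed.

Lemma ev_contraction p u v w :
  ev (\row_i d2form psi p u v (bvec i)) w = d2form psi p u v w.
Proof.
move: (d2form psi p) (d2formD3 p u v) (fun k => d2form_linear3 p k u v) => T TD L.
have z0 : T u v 0 = 0.
  by have := TD 0 0; rewrite addr0 => /eqP; rewrite -subr_eq subrr eq_sym => /eqP.
rewrite evE [in RHS](row_sum_delta w).
rewrite (big_morph (T u v) TD z0); apply: eq_bigr => j _; rewrite mxE.
by have := L (w 0 j) (bvec j) 0; rewrite !addr0 z0 addr0 mulrC => ->.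
Qed.

End ThreeForm.

(** * The big connection and the Courant bracket on sections of E *)

Section Main.
Context {R : realType} {m : nat} {M : smoothManifold R m}.
Variables (G : gen_metric M) (gam psi : M -> 'M[R]_m).
Variables (D : vecfield M -> vecfield M -> vecfield M).
Variables (nabla : vecfield M -> bigfield M -> bigfield M).
Variables (E : M -> {vspace 'rV[R]_m * 'rV[R]_m}).
Variables (Psi : M -> 'End(('rV[R]_m * 'rV[R]_m)%type)) (F : M -> 'M[R]_m).
Hypotheses (gam_metric : riemannian_metric gam) (psi_form : two_form psi).
Hypotheses (GE : corresponds G gam psi).
Hypotheses (D_LC : levi_civita gam D) (nablaE : big_connection gam psi D nabla).
Hypotheses (E_dirac : almost_dirac E).
Hypotheses (PsiE : is_Psi G E Psi) (FE : is_F gam psi Psi F).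
Implicit Types (p q : M) (X Y Z P Q S A B : vecfield M).

Local Notation smooth := (smooth_vec setT).
Local Notation "X '^F'" := (endo_app F X) (at level 2, format "X ^F").
Local Notation sec := (dirac_section gam psi F).
Local Notation g p := (bil (gam p)).

Let gam_smooth : smooth_bil gam. Proof. by have [] := gam_metric. Qed.
Let psi_smooth : smooth_bil psi. Proof. by have [] := psi_form. Qed.

Lemma D_smooth X Y : smooth X -> smooth Y -> smooth (D X Y).
Proof. by have [[H _ _ _ _] _ _] := D_LC; exact: H. Qed.

Lemma D_add X Y Z p : smooth X -> smooth Y -> smooth Z ->
  D X (fun q => Y q + Z q) p = D X Y p + D X Z p.
Proof. by have [[_ _ _ H _] _ _] := D_LC => HX HY HZ; exact: H. Qed.

Lemma D_sub X Y Z p : smooth X -> smooth Y -> smooth Z ->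
  D X (fun q => Y q - Z q) p = D X Y p - D X Z p.
Proof.
move=> HX HY HZ; have HB : smooth (fun q => Y q - Z q) by apply: smooth_vecB => //; exact: openT.
have := D_add p HX HB HZ.
have -> : (fun q => Y q - Z q + Z q) = Y by apply/funext => q; rewrite subrK.
by move=> ->; rewrite addrK.
Qed.

Lemma torsion_free X Y p : smooth X -> smooth Y ->
  lie_bracket X Y p = D X Y p - D Y X p.
Proof. by have [_ H _] := D_LC => HX HY; rewrite H. Qed.

Lemma metric_compat X Y Z p : smooth X -> smooth Y -> smooth Z ->
  dir (X p) (fun q => g q (Y q) (Z q) : R^o) p =
  g p (D X Y p) (Z p) + g p (Y p) (D X Z p).
Proof. by have [_ _ H] := D_LC; move=> HX HY HZ; exact: H. Qed.

Lemma smooth_metric X Y : smooth X -> smooth Y ->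
  smooth_fun (fun q => g q (X q) (Y q)).
Proof. by move=> HX HY; apply: smooth_bilf => //; exact: openT. Qed.

(** The big connection preserves smoothness, hence so does D^+, and
D^+_X Y - D_X Y = sharp (i(Y) i(X) dpsi) / 2. *)
Lemma smooth_d2form X Y Z : smooth X -> smooth Y -> smooth Z ->
  smooth_fun (fun q => d2form psi q (X q) (Y q) (Z q)).
Proof.
move=> HX HY HZ; have [[Hsm _ _ _ _] HE] := nablaE.
have Hl := smooth_lift gam_metric psi_form 1 openT HY.
have [HD _] := Hsm X _ HX Hl.
have HDe : smooth (Deps gam psi D 1 X Y).
  by apply: chartwise_ext openT _ HD => c q _ _ _; rewrite HE //; left.
have H := smooth_funM openT (smooth_fun_cst setT 2)
  (smooth_metric (smooth_vecB openT HDe (D_smooth HX HY)) HZ).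
apply: (chartwise_ext (V := R^o) openT _ H) => c q _ _ _.
rewrite /Deps addrC addKr bilZl bil_sharp ?gam_unit // ev_contraction //.
by rewrite mul1r mulrA divff ?mul1r // pnatr_eq0.
Qed.

(** Every section of TM (+) T*M has this form.  In it the psi-terms of the Courant
bracket separate from the gam-terms: the former contribute the twist by d psi,
the latter are computed with D. *)
Definition graph_section P A : bigfield M :=
  fun q => (P q, flat (psi q) (P q) + flat (gam q) (A q)).

Lemma dirac_sectionE X :
  sec X = graph_section (fun q => X q + X^F q) (fun q => X q - X^F q).
Proof.
apply/funext => q; rewrite /dirac_section /dirac_lift /graph_section /graph_lift.
congr (_, _) => /=; rewrite /flat /endo_app.
rewrite !mulmxDr scale1r scaleN1r !mulmxN !mulmxDl mulNmx.
by rewrite addrACA.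
Qed.

Lemma smooth_graph_cov P A : smooth P -> smooth A ->
  smooth_cov setT (fun q => flat (psi q) (P q) + flat (gam q) (A q)).
Proof.
by move=> HP HA; apply: smooth_covD => //; try exact: openT; apply: smooth_flat => //; exact: openT.
Qed.

(** Writing the two sections as (P, a) and (Q, b), isotropy gives
a(Q) - b(P) = 2 a(Q).  What remains is
  P b(S) - b([P, S]) - Q a(S) + a([Q, S]) + S a(Q);
its psi-part is given by the Cartan formula, and its gam-part follows from metric
compatibility and vanishing torsion. *)
Lemma courant_graph2 P A Q B S p :
  smooth P -> smooth A -> smooth Q -> smooth B -> smooth S ->
  (forall q, g q (A q) (Q q) + g q (B q) (P q) = 0) ->
  ev (courant (graph_section P A) (graph_section Q B) p).2 (S p) =
  d2form psi p (P p) (Q p) (S p) + bil (psi p) (lie_bracket P Q p) (S p)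
  + g p (D P B p) (S p) + g p (B p) (D S P p)
  - g p (D Q A p) (S p) + g p (D S A p) (Q p).
Proof.
move=> HP HA HQ HB HS iso; have [_ alt] := psi_form.
have Ha := smooth_graph_cov HP HA; have Hb := smooth_graph_cov HQ HB.
set a := (fun q => _) in Ha; set b := (fun q => _) in Hb.
have aQ q : ev (a q) (Q q) - ev (b q) (P q) = ev (a q) (Q q) + ev (a q) (Q q).
  rewrite /a /b !evDl !ev_flat (alt q (Q q)).
  have -> : g q (B q) (P q) = - g q (A q) (Q q).
    by apply/eqP; rewrite -addr_eq0 addrC iso.
  ring.
have dsplit (w : 'rV[R]_m) P' A' Z : smooth P' -> smooth A' -> smooth Z ->
    dir w (fun q => ev (flat (psi q) (P' q) + flat (gam q) (A' q)) (Z q) : R^o) p =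
    dir w (fun q => bil (psi q) (P' q) (Z q) : R^o) p +
    dir w (fun q => g q (A' q) (Z q) : R^o) p.
  move=> HP' HA' HZ; rewrite -dirD; last first.
  - by apply: smooth_bilf => //; exact: openT.
  - by apply: smooth_bilf => //; exact: openT.
  by apply: (f_equal (fun f : _ -> R^o => dir w f p)); apply/funext => q;
    rewrite evDl !ev_flat.
have -> : (courant (graph_section P A) (graph_section Q B) p).2 =
    lie_derivative P b p - lie_derivative Q a p
    + 2^-1 *: dfun (fun q => ev (a q) (Q q) - ev (b q) (P q)) p by [].
rewrite evDl evBl evZl (funext aQ).
have HaQ : smooth_fun (fun q => ev (a q) (Q q)) by apply: smooth_ev => //; exact: openT.
rewrite ev_dfun; last by apply: smooth_funD => //; exact: openT.
(* l1, l2, l3: the two Lie derivatives and the exact term; x = u + v: the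
   derivatives of b(S), a(S), a(Q), split into psi- and gam-parts; y1, y2: the
   values on [P, S], [Q, S]; d, c1, c2, c3: d psi and its bracket terms. *)
have alg (l1 l2 l3 x1 x2 x3 u1 u2 u3 v1 v2 v3 y1 y2 c1 c2 c3 d e1 e2 e3 f1 f2 f3 h1 : R) :
    l1 = x1 - y1 -> l2 = x2 - y2 -> l3 = x3 + x3 ->
    x1 = u1 + v1 -> x2 = u2 + v2 -> x3 = u3 + v3 ->
    d = u1 - u2 + u3 - c1 + c2 - c3 ->
    v1 = e1 + f1 -> v2 = e2 + f2 -> v3 = e3 + f3 ->
    y1 = - c2 + (f1 - h1) -> y2 = - c3 + (f2 - f3) ->
    l1 - l2 + 2^-1 * l3 = d + c1 + e1 + h1 - e2 + e3.
  by move=> -> -> -> -> -> -> -> -> -> -> -> ->; field.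
apply: (alg _ _ _ _ _ _ _ _ _ _ _ _ _ _ _ _ _ _ _ _ _ _ _ _ _
  (ev_lie_derivative p HP Hb HS) (ev_lie_derivative p HQ Ha HS) (dirD p (S p) HaQ HaQ)
  (dsplit (P p) Q B S HQ HB HS) (dsplit (Q p) P A S HP HA HS)
  (dsplit (S p) P A Q HP HA HQ) (cartan_formula p psi_form HP HQ HS)
  (metric_compat p HP HB HS) (metric_compat p HQ HA HS) (metric_compat p HS HA HQ)).
- rewrite /b evDl !ev_flat (torsion_free p HP HS) (alt p (Q p)).
  by move: (D P S p) (D S P p) => w w'; rewrite (bilBr (gam p)).
- rewrite /a evDl !ev_flat (torsion_free p HQ HS) (alt p (P p)).
  by move: (D Q S p) (D S Q p) => w w'; rewrite (bilBr (gam p)).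
Qed.

Lemma smooth_XF X : smooth X -> smooth X^F.
Proof. exact: (smooth_F gam_metric psi_form GE E_dirac PsiE FE). Qed.

Lemma isoF p u v : g p (u *m F p) (v *m F p) = g p u v.
Proof. exact: (F_isometry gam_metric psi_form GE E_dirac PsiE FE). Qed.

(** The first equation of the theorem for a single tangent vector w. *)
Definition derivative_condition p X Y (w : 'rV[R]_m) :=
  g p (w *m F p) (cov_deriv D F X Y p) =
  2^-1 * (d2form psi p (X p) (Y p) w + d2form psi p (X p) (Y^F p) (w *m F p)).

Lemma nabla_sectionE X Y p : smooth X -> smooth Y ->
  nabla X (sec Y) p =
  graph_lift gam psi 1 p (Deps gam psi D 1 X Y p) +
  graph_lift gam psi (-1) p (Deps gam psi D (-1) X Y^F p).
Proof.
move=> HX HY; have [[_ _ _ Hadd _] HE] := nablaE.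
have HYF := smooth_XF HY.
have Hp := smooth_lift gam_metric psi_form 1 openT HY.
have Hm := smooth_lift gam_metric psi_form (-1) openT HYF.
have := Hadd X _ _ HX Hp Hm p; rewrite (HE 1) //; last by left.
by rewrite (HE (-1)) //; right.
Qed.

Lemma defect_pairing p (v v' a b w : 'rV[R]_m) (r r' : R) :
  g p b w = r -> g p a (w *m F p) = r' ->
  g p (w *m F p) (v' + (-1 / 2) *: a - (v + (1 / 2) *: b) *m F p) =
  g p (w *m F p) (v' - v *m F p) - 2^-1 * (r + r').
Proof.
move=> <- <-; rewrite mulmxDl -scalemxAl -(isoF p b).
rewrite (gam_sym gam_metric p a) (gam_sym gam_metric p (b *m _)).
by rewrite !(bilDr, bilNr, bilZr); field.
Qed.

(** The derivative lies in E iff D^-_X (F Y) = F (D^+_X Y); this vector equation is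
tested against F w, which is an arbitrary vector because F is invertible. *)
Lemma nabla_in_dirac X Y p : smooth X -> smooth Y ->
  nabla X (sec Y) p \in E p <-> forall w, derivative_condition p X Y w.
Proof.
move=> HX HY; rewrite (nabla_sectionE p HX HY).
rewrite (lift_dirac gam_metric psi_form GE E_dirac PsiE FE).
have ug := gam_unit gam_metric p.
have key w : g p (w *m F p) (Deps gam psi D (-1) X Y^F p - Deps gam psi D 1 X Y p *m F p) =
    g p (w *m F p) (cov_deriv D F X Y p) - 2^-1 * (d2form psi p (X p) (Y p) w +
      d2form psi p (X p) (Y^F p) (w *m F p)).
  exact: (defect_pairing _ _
    (etrans (bil_sharp _ _ ug) (ev_contraction psi_form p (X p) (Y p) w))
    (etrans (bil_sharp _ _ ug) (ev_contraction psi_form p (X p) (Y^F p) (w *m F p)))).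
split=> [e w|H].
  have := key w; rewrite e subrr {1}/bil linear0 mulmx0 mxE => /esym/eqP.
  by rewrite subr_eq0 => /eqP.
apply/eqP; rewrite -subr_eq0; apply/eqP; set z := _ - _.
apply: (gam_eq0 gam_metric (p := p)); rewrite -{1}(mulmxKV (F_unit gam_metric psi_form GE E_dirac PsiE FE p) z).
rewrite key.
by have := H (z *m invmx (F p)); rewrite /derivative_condition => ->; rewrite subrr.
Qed.

(** With F (D_U X) taken out of D_U (F X), the remaining terms cancel because F is an
isometry. *)
Lemma connection_defect U X Y p : smooth U -> smooth X -> smooth Y ->
  g p (D U (fun q => X q - X^F q) p) (Y p + Y^F p) +
  g p (Y p - Y^F p) (D U (fun q => X q + X^F q) p) =
  - 2 * g p (Y p *m F p) (cov_deriv D F U X p).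
Proof.
move=> HU HX HY; rewrite (D_sub p HU HX (smooth_XF HX)) (D_add p HU HX (smooth_XF HX)).
rewrite /cov_deriv; have e := isoF p (Y p) (D U X p).
rewrite /endo_app -/(X^F); move: (D U X^F p) (D U X p) e => a b e.
rewrite !(bilDr, bilNr, bilDl, bilNl) e.
rewrite (gam_sym gam_metric p a) (gam_sym gam_metric p b (Y p)).
rewrite (gam_sym gam_metric p a) (gam_sym gam_metric p b).
ring.
Qed.

Lemma smooth_sum X : smooth X -> smooth (fun q => X q + X^F q).
Proof. by move=> HX; exact: (smooth_vecD openT HX (smooth_XF HX)). Qed.

Lemma smooth_diff X : smooth X -> smooth (fun q => X q - X^F q).
Proof. by move=> HX; exact: (smooth_vecB openT HX (smooth_XF HX)). Qed.

Lemma sum_diff_isotropic X Y q :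
  g q (X q - X^F q) (Y q + Y^F q) + g q (Y q - Y^F q) (X q + X^F q) = 0.
Proof.
rewrite /endo_app !(bilDr, bilNr, bilDl, bilNl) !isoF.
rewrite (gam_sym gam_metric q (Y q) (X q)).
rewrite (gam_sym gam_metric q (Y q) (X q *m F q)).
rewrite (gam_sym gam_metric q (Y q *m F q) (X q)); ring.
Qed.

(** The pairing is d psi(P, Q, S) plus three terms of the form of
[connection_defect], in the directions P, Q and S.  The hypothesis is needed for
these directions, that is, for fields other than X, Y and Z. *)
Lemma courant_pairing X Y Z p : smooth X -> smooth Y -> smooth Z ->
  (forall U V, smooth U -> smooth V -> forall w, derivative_condition p U V w) ->
  neutral (courant (sec X) (sec Y) p) (sec Z p) =
  - 2 * (d2form psi p (X p) (Y p) (Z p) +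
         d2form psi p (X^F p) (Y^F p) (Z^F p)).
Proof.
move=> HX HY HZ cond.
rewrite !dirac_sectionE.
set P := fun q => X q + X^F q; set A := fun q => X q - X^F q.
set Q := fun q => Y q + Y^F q; set B := fun q => Y q - Y^F q.
set S := fun q => Z q + Z^F q; set C := fun q => Z q - Z^F q.
have [HP HA] : smooth P /\ smooth A := conj (smooth_sum HX) (smooth_diff HX).
have [HQ HB] : smooth Q /\ smooth B := conj (smooth_sum HY) (smooth_diff HY).
have HS : smooth S := smooth_sum HZ.
have iso := sum_diff_isotropic X Y.
have E2 := courant_graph2 p HP HA HQ HB HS iso.
have T1 := connection_defect p HP HY HZ; have T2 := connection_defect p HQ HX HZ.
have T3 := connection_defect p HS HX HY.
have c1 := cond P Y HP HY (Z p); have c2 := cond Q X HQ HX (Z p).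
have c3 := cond S X HS HX (Y p).
have pairing : neutral (courant (graph_section P A) (graph_section Q B) p)
    (graph_section S C p) =
    d2form psi p (P p) (Q p) (S p) +
    (g p (D P B p) (S p) + g p (C p) (D P Q p)) -
    (g p (D Q A p) (S p) + g p (C p) (D Q P p)) +
    (g p (D S A p) (Q p) + g p (B p) (D S P p)).
  have alg (c d s b1 b2 b3 b4 r1 r2 e : R) :
      c = d + s + b1 + b2 - b3 + b4 -> e = - s + (r1 - r2) ->
      c + e = d + (b1 + r1) - (b3 + r2) + (b4 + b2).
    by move=> -> ->; ring.
  apply: (alg _ _ _ _ _ _ _ _ _ _ E2).
  rewrite /= evDl !ev_flat; have [_ ->] := psi_form; congr (_ + _).
  rewrite (torsion_free p HP HQ).
  by move: (D P Q p) (D Q P p) => v v'; rewrite bilDr bilNr.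
rewrite {}pairing.
move: T1 T2 T3 c1 c2 c3; rewrite /derivative_condition.
move: (d2form psi p) (d2form_swap12 psi_form p) (d2form_swap23 psi_form p)
  (d2formD1 psi_form p) (d2formD2 psi_form p) (d2formD3 psi_form p)
  => T s12 s23 D1 D2 D3 -> -> -> -> -> ->.
rewrite /P /Q /S /endo_app !(D1, D2, D3).
move: (X p) (Y p) (Z p) (X p *m F p) (Y p *m F p) (Z p *m F p) => x y z x' y' z'.
(* Sort the arguments of every term, so that the twelve values of d psi subtracted
   by the hypothesis meet the eight in the expansion of d psi(P, Q, S). *)
rewrite (s12 y x z) (s12 y x' z') (s12 y' x z) (s12 y' x' z').
rewrite (s12 z x y) (s12 z' x y) (s12 z x' y') (s12 z' x' y').
rewrite (s23 x z y) (s23 x z' y) (s23 x' z y') (s23 x' z' y').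
by field.
Qed.

(** Both components are expressed through D and d psi, which preserve smoothness; for
the covector part this is enough by [smooth_cov_test]. *)
Lemma courant_section_smooth X Y : smooth X -> smooth Y ->
  smooth_big setT (courant (sec X) (sec Y)).
Proof.
move=> HX HY.
rewrite !dirac_sectionE.
set P := fun q => X q + X^F q; set A := fun q => X q - X^F q.
set Q := fun q => Y q + Y^F q; set B := fun q => Y q - Y^F q.
have [HP HA] : smooth P /\ smooth A := conj (smooth_sum HX) (smooth_diff HX).
have [HQ HB] : smooth Q /\ smooth B := conj (smooth_sum HY) (smooth_diff HY).
have iso := sum_diff_isotropic X Y.
have HL : smooth (lie_bracket P Q).
  have -> : lie_bracket P Q = fun q => D P Q q - D Q P q.
    by apply/funext => q; exact: torsion_free.
  by apply: smooth_vecB; [exact: openT|exact: D_smooth|exact: D_smooth].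
split; first exact: HL.
apply: smooth_cov_test => S HS.
have -> : (fun q => ev (courant (graph_section P A) (graph_section Q B) q).2 (S q)) =
  fun q => d2form psi q (P q) (Q q) (S q) + bil (psi q) (lie_bracket P Q q) (S q)
  + g q (D P B q) (S q) + g q (B q) (D S P q)
  + - g q (D Q A q) (S q) + g q (D S A q) (Q q).
  by apply/funext => q; exact: courant_graph2.
apply: smooth_funD; [exact: openT| |exact: smooth_metric (D_smooth HS HA) HQ].
apply: smooth_funD; [exact: openT| |apply: smooth_funN; first exact: openT];
  last exact: smooth_metric (D_smooth HQ HA) HS.
apply: smooth_funD; [exact: openT| |exact: smooth_metric HB (D_smooth HS HP)].
apply: smooth_funD; [exact: openT| |exact: smooth_metric (D_smooth HP HB) HS].
apply: smooth_funD; [exact: openT|exact: smooth_d2form HP HQ HS|].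
exact: smooth_bilf openT psi_smooth HL HS.
Qed.

Lemma parallel_dirac_iff : (courant_integrable E /\ preserves nabla E) <->
  (forall X Y Z, smooth X -> smooth Y -> smooth Z ->
     (forall p, derivative_condition p X Y (Z p)) /\
     (forall p, d2form psi p (X p) (Y p) (Z p) +
                d2form psi p (X^F p) (Y^F p) (Z^F p) = 0)).
Proof.
have secG X : smooth X -> global_section E (sec X).
  exact: (dirac_section_global gam_metric psi_form GE E_dirac PsiE FE).
have Gsec s : global_section E s -> exists2 X, smooth X & s = sec X.
  exact: (global_section_dirac gam_metric psi_form GE E_dirac PsiE FE).
split=> [[integ pres] X Y Z HX HY HZ|cond].
  have dc U V p : smooth U -> smooth V -> forall w, derivative_condition p U V w.
    move=> HU HV; apply/(nabla_in_dirac p HU HV).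
    by have [_] := pres U (sec V) HU (secG V HV).
  split=> p; first exact: dc.
  have := courant_pairing HX HY HZ (fun U V => @dc U V p).
  have [_ cE] := integ _ _ (secG X HX) (secG Y HY).
  have [_ iso] := E_dirac; rewrite (iso p _ _ (cE p) ((secG Z HZ).2 p)).
  by move=> /esym/eqP; rewrite mulf_eq0 oppr_eq0 pnatr_eq0 => /eqP.
have dc p U V w : smooth U -> smooth V -> derivative_condition p U V w.
  move=> HU HV; have [Z HZ <-] := exists_smooth_vec p w.
  exact: (cond U V Z HU HV HZ).1.
split=> [s t|X s HX] /Gsec[Y HY ->].
  move=> /Gsec[Y' HY' ->]; split; first exact: courant_section_smooth.
  move=> p; apply: (dirac_maximal gam_metric psi_form GE E_dirac PsiE FE) => u.
  have [Z HZ <-] := exists_smooth_vec p u.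
  have H := courant_pairing HY HY' HZ (fun U V HU HV w => dc p U V w HU HV).
  by rewrite [LHS]H (cond Y Y' Z HY HY' HZ).2 mulr0.
have [Hs _] := secG Y HY; have [[Hn _ _ _ _] _] := nablaE.
split; first exact: Hn.
by move=> p; apply/(nabla_in_dirac p HX HY) => w; exact: dc.
Qed.

End Main.

Unset Implicit Arguments.

Theorem proposition3p5 (R : realType) (m : nat) (M : smoothManifold R m)
  (G : gen_metric M) (gam psi : M -> 'M[R]_m)
  (D : vecfield M -> vecfield M -> vecfield M)
  (nabla : vecfield M -> bigfield M -> bigfield M)
  (E : M -> {vspace 'rV[R]_m * 'rV[R]_m})
  (Psi : M -> 'End(('rV[R]_m * 'rV[R]_m)%type))
  (F : M -> 'M[R]_m) :
  riemannian_metric gam ->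
  two_form psi ->
  corresponds G gam psi ->
  levi_civita gam D ->
  big_connection gam psi D nabla ->
  almost_dirac E ->
  is_Psi G E Psi ->
  is_F gam psi Psi F ->
  (courant_integrable E /\ preserves nabla E)
  <->
  (forall X Y Z : vecfield M,
     smooth_vec setT X -> smooth_vec setT Y -> smooth_vec setT Z ->
     (forall p,
        bil (gam p) (endo_app F Z p) (cov_deriv D F X Y p) =
        2^-1 * (d2form psi p (X p) (Y p) (Z p) +
                d2form psi p (X p) (endo_app F Y p) (endo_app F Z p))) /\
     (forall p,
        d2form psi p (X p) (Y p) (Z p) +
        d2form psi p (endo_app F X p) (endo_app F Y p) (endo_app F Z p) = 0)).
Proof.
move=> gam_metric psi_form GE D_LC nablaE E_dirac PsiE FE.
exact: (parallel_dirac_iff gam_metric psi_form GE D_LC nablaE E_dirac PsiE FE).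
Qed.
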